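(* Let $f,h,g$ satisfy the standing assumptions (A1)–(A5) of the context, and let $L_h>0$ be the Lipschitz constant of $\nabla h$ in (A2). Suppose in addition that: (1) $f$ is locally Lipschitz continuous on $\mathrm{dom}\,f$, i.e., for any $\bm{x}\in\mathrm{dom}\,f$ there exist a neighborhood $\mathcal{O}$ of $\bm{x}$ and a constant $L_x>0$ such that $|f(\bm{u})-f(\bm{v})|\le L_x\|\bm{u}-\bm{v}\|$ for all $\bm{u},\bm{v}\in\mathcal{O}\cap\mathrm{dom}\,f$; (2) $g$ is continuously differentiable on $\Omega$ with a locally Lipschitz continuous gradient; (3) $\{\bm{x}^k\}$ is a sequence generated by the iVPGSA described in the context, and there exists an integer $K_0>0$ such that $\delta_k=0$ for all $k\ge K_0$; (4) there exist $\underline{\gamma},\overline{\gamma}>0$ such that $\frac{L_h}{2}<\underline{\gamma}\le\overline{\gamma}$ and $\underline{\gamma}I_n\preceq H_k\preceq\overline{\gamma}I_n$ for all $k\ge0$; (5) for some $\tau>1$, $\sum_{k=0}^{\infty}\varepsilon_k<+\infty$, $\sum_{k=0}^{\infty}\sqrt{\varepsilon_k}<+\infty$, $\sum_{k=0}^{\infty}\big(\sum_{i=k}^{\infty}\varepsilon_i\big)^{1-\frac1\tau}<+\infty$; (6) $F$ is a KL function with an exponent $\theta_F\in[0,1)$. Let $\bm{x}^*$ be the limit of $\{\bm{x}^k\}$ (which exists in each of the cases below) and let $\varepsilon_0>0$. Then the following statements hold. (i) If $\theta_F=0$, for all sufficiently large $k$: (a) for $\varepsilon_k=\varepsilon_0\zeta^k$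 with $0<\zeta<1$, there exists $\varrho_1\in(0,1)$ such that $\|\bm{x}^k-\bm{x}^*\|\le\mathcal{O}(\varrho_1^k)$; (b) for $\varepsilon_k=\frac{\varepsilon_0}{(k+1)^q}$ with $q>2$, $\|\bm{x}^k-\bm{x}^*\|\le\mathcal{O}\big(k^{-(\frac q2-1)}\big)$. (ii) If $\theta_F\in(0,\frac12]$, for all sufficiently large $k$: (a) for $\varepsilon_k=\varepsilon_0\zeta^k$ with $0<\zeta<1$, there exists $\varrho_2\in(0,1)$ such that $\|\bm{x}^k-\bm{x}^*\|\le\mathcal{O}(\varrho_2^k)$; (b) for $\varepsilon_k=\frac{\varepsilon_0}{(k+1)^q}$ with $q>2$, $\|\bm{x}^k-\bm{x}^*\|\le\mathcal{O}\big(k^{-(\frac q2-1)}\big)$. (iii) If $\theta_F\in(\frac12,1)$, for all sufficiently large $k$: (a) for $\varepsilon_k=\varepsilon_0\zeta^k$ with $0<\zeta<1$, $\|\bm{x}^k-\bm{x}^*\|\le\mathcal{O}\big(k^{-\frac{1-\theta_F}{2\theta_F-1}}\big)$; (b) for $\varepsilon_k=\frac{\varepsilon_0}{(k+1)^q}$ with $q>2$, $$\|\bm{x}^k-\bm{x}^*\|\le\begin{cases}\mathcal{O}\big(k^{-(\frac q2-1)}\big), & \text{if } q<\frac{2\theta_F}{2\theta_F-1},\\ \mathcal{O}\big(k^{-\frac{1-\theta_F}{2\theta_F-1}}\big), & \text{otherwise}.\end{cases}$$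
   Context: Notation. $\|\cdot\|$ is the Euclidean norm; $I_n$ is the $n\times n$ identity; $\preceq$ is the Loewner order. ''$a_k\le\mathcal{O}(b_k)$ for all sufficiently large $k$'' means there are $C>0$ and $\bar k$ with $a_k\le Cb_k$ for all $k\ge\bar k$. For a proper closed convex function $f$, $\delta\ge 0$ and $\bm{x}\in\mathrm{dom}\,f$, $\partial_\delta f(\bm{x}):=\{\bm{d}: f(\bm{y})\ge f(\bm{x})+\langle \bm{d},\bm{y}-\bm{x}\rangle-\delta\ \ \forall \bm{y}\in\mathbb{R}^n\}$, and $\partial f=\partial_0 f$. For a general proper closed function $\psi$, $\partial\psi$ is the limiting subdifferential: $\widehat\partial\psi(\bm{x}):=\{\bm{d}:\liminf_{\bm{y}\to\bm{x},\bm{y}\ne\bm{x}}\frac{\psi(\bm{y})-\psi(\bm{x})-\langle\bm{d},\bm{y}-\bm{x}\rangle}{\|\bm{y}-\bm{x}\|}\ge0\}$, and $\partial\psi(\bm{x})$ is the set of limits of $\bm{d}^k\in\widehat\partial\psi(\bm{x}^k)$ with $\bm{x}^k\to\bm{x}$ and $\psi(\bm{x}^k)\to\psi(\bm{x})$. Problem. Consider $\min_{\bm{x}\in\Omega}\frac{f(\bm{x})+h(\bm{x})}{g(\bm{x})}$, where $\Omega:=\{\bm{x}\in\mathbb{R}^n: g(\bm{x})\neq0\}$ is nonempty, and define $F(\bm{x}):=\frac{f(\bm{x})+h(\bm{x})}{g(\bm{x})}$ if $\bm{x}\in\mathrm{dom}\,f\cap\Omega$, and $F(\bm{x}):=+\infty$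 otherwise. Standing assumptions. (A1) $f:\mathbb{R}^n\to\mathbb{R}\cup\{+\infty\}$ is proper, closed and convex. (A2) $h:\mathbb{R}^n\to\mathbb{R}$ is continuously differentiable (possibly nonconvex) and there is $L_h>0$ with $\|\nabla h(\bm{x})-\nabla h(\bm{y})\|\le L_h\|\bm{x}-\bm{y}\|$ for all $\bm{x},\bm{y}$. (A3) $g:\mathbb{R}^n\to\mathbb{R}$ is continuous, convex, and nonnegative over $\mathrm{dom}\,f$. (A4) $f+h$ is nonnegative on $\mathrm{dom}\,f$, and $f(\bm{x})+h(\bm{x})>0$ when $g(\bm{x})=0$. (A5) $F$ is level-bounded: for every $\alpha\in\mathbb{R}$ the set $\{\bm{x}:F(\bm{x})\le\alpha\}$ is bounded (possibly empty). Algorithm (iVPGSA). Input: $\bm{x}^0\in\Omega\cap\mathrm{dom}\,f$, nonnegative scalars $\{\varepsilon_k\}_{k\ge0}$, symmetric positive definite matrices $\{H_k\}_{k\ge0}\subset\mathbb{R}^{n\times n}$. For each $k=0,1,2,\dots$: set $c_k=\frac{f(\bm{x}^k)+h(\bm{x}^k)}{g(\bm{x}^k)}$ and take any $\bm{y}^k\in\partial g(\bm{x}^k)$; find $\bm{x}^{k+1}\in\Omega\cap\mathrm{dom}\,f$ and an error pair $(\Delta^k,\delta_k)\in\mathbb{R}^n\times[0,\infty)$ such that $$\Delta^k\in\partial_{\delta_k}f(\bm{x}^{k+1})+\nabla h(\bm{x}^k)-c_k\bm{y}^k+H_k(\bm{x}^{k+1}-\bm{x}^k)$$ and $$\|\Delta^k\|^2+|\langle\Delta^k,\bm{x}^{k+1}-\bm{x}^k\rangle|+\delta_k\le\varepsilon_k\,g(\bm{x}^{k+1}).$$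 The generated sequence $\{\bm{x}^k\}_{k\ge 0}$ is infinite. KL exponent. A proper closed function $\psi:\mathbb{R}^N\to\mathbb{R}\cup\{+\infty\}$ has the KL property at $\tilde{\bm{x}}\in\mathrm{dom}\,\partial\psi:=\{\bm{x}:\partial\psi(\bm{x})\ne\emptyset\}$ with an exponent $\theta\in[0,1)$ if there exist $a,\mu,\nu>0$ such that $\mathrm{dist}(0,\partial\psi(\bm{x}))\ge a(\psi(\bm{x})-\psi(\tilde{\bm{x}}))^\theta$ whenever $\bm{x}\in\mathrm{dom}\,\partial\psi$, $\|\bm{x}-\tilde{\bm{x}}\|\le\mu$ and $\psi(\tilde{\bm{x}})<\psi(\bm{x})<\psi(\tilde{\bm{x}})+\nu$. $\psi$ is a KL function with an exponent $\theta$ if this holds, with the same $\theta$, at every $\tilde{\bm{x}}\in\mathrm{dom}\,\partial\psi$. *)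

(* Defs.v *)
From HB Require Import structures.
From mathcomp Require Import all_boot all_order all_algebra.
From mathcomp Require Import all_classical all_reals all_analysis.
Set Implicit Arguments.
Unset Strict Implicit.
Unset Printing Implicit Defensive.
Import Order.TTheory GRing.Theory Num.Theory.
Import numFieldNormedType.Exports.
Local Open Scope classical_set_scope.
Local Open Scope ring_scope.

(* Vectors of R^n are rows: the product of a symmetric matrix H and a vector u
   is written u *m H.  The library norm `|u| on 'rV_n is the max norm; it is
   used only through the topology and boundedness, which do not depend on the
   norm.  All quantitative estimates use enorm. *)
Section euclidean.
Context {R : realType} {n : nat}.
Implicit Types (u v : 'rV[R]_n) (A B : 'M[R]_n).

Definition dot u v : R := \sum_(i < n) u 0 i * v 0 i.

Definition enorm u : R := Num.sqrt (dot u u).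

Definition posdef A := A^T = A /\ forall u, u != 0 -> 0 < dot (u *m A) u.

Definition possemidef A := A^T = A /\ forall u, 0 <= dot (u *m A) u.

Definition loewner_le A B := possemidef (B - A).

(* Meaningful at points where phi is differentiable. *)
Definition gradient (phi : 'rV[R]_n -> R) (x : 'rV[R]_n) : 'rV[R]_n :=
  \row_(i < n) 'D_(delta_mx 0 i) (phi : 'rV[R]_n -> R^o) x.

Definition continuously_differentiable_on (D : set 'rV[R]_n)
    (phi : 'rV[R]_n -> R) :=
  forall x, D x ->
    differentiable (phi : 'rV[R]_n -> R^o) x /\
    {for x, continuous (gradient phi)}.

End euclidean.

(* Functions R^n -> R \cup {+oo} are maps to \bar R that avoid -oo (which is
   part of properness). *)
Section extended_real_valued.
Context {R : realType} {n : nat}.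
Implicit Types (psi : 'rV[R]_n -> \bar R) (x d : 'rV[R]_n).

Definition edom psi : set 'rV[R]_n := [set x | (psi x < +oo)%E].

Definition eproper psi := (forall x, psi x != -oo%E) /\ edom psi !=set0.

Definition econvex psi := forall (x y : 'rV[R]_n) (t : R), 0 <= t <= 1 ->
  (psi (t *: x + (1 - t) *: y)%R <= t%:E * psi x + (1 - t)%:E * psi y)%E.

Definition eps_subdiff psi (delta : R) x : set 'rV[R]_n :=
  [set d | forall y : 'rV[R]_n,
    (psi x + (dot d (y - x))%:E - delta%:E <= psi y)%E].

(* As usual, both subdifferentials below are empty outside the domain. *)
Definition frechet_subdiff psi x : set 'rV[R]_n :=
  [set d | edom psi x /\
    (0 <= limf_einf (fun y : 'rV[R]_n =>
            (psi y - psi x - (dot d (y - x))%:E) * ((enorm (y - x))^-1)%:E)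
          (x^'))%E].

Definition limiting_subdiff psi x : set 'rV[R]_n :=
  [set d | edom psi x /\
    exists xs ds : nat -> 'rV[R]_n,
    [/\ forall k, frechet_subdiff psi (xs k) (ds k),
        xs @ \oo --> x, psi (xs k) @[k --> \oo] --> psi x
      & ds @ \oo --> d]].

(* +oo if S is empty *)
Definition dist0 (S : set 'rV[R]_n) : \bar R :=
  ereal_inf [set (enorm d)%:E | d in S].

Definition KL_at psi (theta : R) (xt : 'rV[R]_n) :=
  exists a mu nu : R, [/\ 0 < a, 0 < mu, 0 < nu &
    forall x, limiting_subdiff psi x !=set0 -> enorm (x - xt) <= mu ->
      (psi xt < psi x)%E -> (psi x < psi xt + nu%:E)%E ->
      (a%:E * (psi x - psi xt) `^ theta <= dist0 (limiting_subdiff psi x))%E].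

Definition KL_function psi (theta : R) :=
  0 <= theta < 1 /\
  forall xt, limiting_subdiff psi xt !=set0 -> KL_at psi theta xt.

End extended_real_valued.

Section fractional_program.
Context {R : realType} {n : nat}.
Variables (f : 'rV[R]_n -> \bar R) (h g : 'rV[R]_n -> R).

Definition Omega : set 'rV[R]_n := [set x | g x != 0].

(* Used only on edom f, where f is finite. *)
Definition fracval (x : 'rV[R]_n) : R := (fine (f x) + h x) / g x.

Definition objective (x : 'rV[R]_n) : \bar R :=
  if (f x < +oo)%E && (g x != 0) then (fracval x)%:E else +oo%E.

Record standing_assumptions (Lh : R) : Prop := StandingAssumptions {
  Omega_nonempty : Omega !=set0;
  f_proper : eproper f;
  f_closed : lower_semicontinuous f;
  f_convex : econvex f;
  h_C1 : continuously_differentiable_on setT h;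
  Lh_gt0 : 0 < Lh;
  h_gradient_lipschitz : forall x y,
    enorm (gradient h x - gradient h y) <= Lh * enorm (x - y);
  g_continuous : continuous g;
  g_convex : convex_function setT g;
  g_nonneg : forall x, edom f x -> 0 <= g x;
  numerator_nonneg : forall x, edom f x -> (0 <= f x + (h x)%:E)%E;
  numerator_pos : forall x, g x = 0 -> (0 < f x + (h x)%:E)%E;
  objective_level_bounded : forall alpha : R,
    bounded_set [set x | (objective x <= alpha%:E)%E]
}.

Definition f_locally_lipschitz := forall x, edom f x ->
  exists O (L : R), [/\ nbhs x O, 0 < L &
    forall u v, O u -> edom f u -> O v -> edom f v ->
      `|fine (f u) - fine (f v)| <= L * enorm (u - v)].

Definition g_gradient_locally_lipschitz := forall x, Omega x ->
  exists O (L : R), [/\ nbhs x O, 0 < L &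
    forall u v, O u -> Omega u -> O v -> Omega v ->
      enorm (gradient g u - gradient g v) <= L * enorm (u - v)].

Record iVPGSA (eps : nat -> R) (H : nat -> 'M[R]_n)
    (x y Delta : nat -> 'rV[R]_n) (delta : nat -> R) : Prop := IVPGSA {
  eps_nonneg : forall k, 0 <= eps k;
  H_posdef : forall k, posdef (H k);
  iterates_feasible : forall k, (Omega `&` edom f) (x k);
  y_subgradient : forall k, eps_subdiff (EFin \o g) 0 (x k) (y k);
  delta_nonneg : forall k, 0 <= delta k;
  inexact_step : forall k,
    [set xi + gradient h (x k) - fracval (x k) *: y k
        + (x k.+1 - x k) *m H k
      | xi in eps_subdiff f (delta k) (x k.+1)] (Delta k);
  error_criterion : forall k,
    enorm (Delta k) ^+ 2 + `|dot (Delta k) (x k.+1 - x k)| + delta k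
      <= eps k * g (x k.+1)
}.

End fractional_program.

Definition eventually_bigO {R : realType} (a b : nat -> R) :=
  exists2 C : R, 0 < C & \forall k \near \oo, a k <= C * b k.

(* Main.v *)
Require Import Defs.
From mathcomp Require Import all_boot all_order all_algebra.
From mathcomp Require Import all_classical all_reals all_analysis.
From mathcomp Require Import ring lra.
Set Implicit Arguments.
Unset Strict Implicit.
Unset Printing Implicit Defensive.
Import Order.TTheory GRing.Theory Num.Theory.
Import numFieldNormedType.Exports.
Local Open Scope classical_set_scope.
Local Open Scope ring_scope.

(** The objective values [c k = F (x k)] decrease up to the errors. Testing the
    inexact optimality condition of a step against the previous iterate, the
    [eps]-subgradient inequality for [f], the descent lemma for [h] and the
    subgradient inequality for [g] combine, because [Lh / 2 < gamma_lo], into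
    [a * d k ^+ 2 <= r k - r k.+1], where [d k] is the length of the step,
    [E k] is the sum of the remaining errors, [cs] is the limit of [c k + E k]
    and [r k = c k + E k - cs]. Level-boundedness bounds the iterates, so they
    have a cluster point [xb]; lower semicontinuity of [f] and positivity of the
    numerator where [g] vanishes show that [xb] is feasible, with value [cs].

    Near [xb] all the data are Lipschitz, so as soon as [delta k = 0] the
    optimality condition yields a subgradient of [F] at [x k.+1] of size
    [O(d k + sqrt (eps k))]. Hence [0] is a limiting subgradient at [xb], the
    Kurdyka-Lojasiewicz inequality is available there, and for every exponent
    [t] in (0, 1) with [theta <= t] it reads
    [r k.+1 `^ t <= C * (d k + e k)], with
    [e k = sqrt (eps k) + E k.+1 `^ t].
    With concavity of the power [1 - t] this gives
    [2 * d k.+1 <= d k + e k + M * (r k.+1 `^ (1 - t) - r k.+2 `^ (1 - t))],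
    which telescopes. For [t = max theta (1 - 1 / tau)] the errors [e k] are
    summable, and the trajectory is trapped in every ball around [xb], so it
    converges to [xb].

    For the rates, let [T k] be the length of the trajectory after [x k]; it
    bounds the distance to the limit, [d k = T k - T k.+1], and telescoping
    gives [T k.+1 <= d k + Q k + M * r k.+1 `^ (1 - t)] with [Q k] the tail of
    [e]. The exponent [t] may be chosen freely above [theta]. With [t = 1 / 2]
    and geometric errors this is a perturbed linear contraction. With
    [t = (1 + al) / (1 + 2 * al)] it becomes
    [T k.+1 `^ ((1 + al) / al) <= C * (T k - T k.+1) + C * k.+1 `^ (- (1 + al))],
    whose solutions are [O(k ^ (- al))]. Errors of order [k ^ (- q)] allow every
    [al <= q / 2 - 1], geometric errors every [al], and [theta <= t] means
    [al <= (1 - theta) / (2 * theta - 1)] when [1 / 2 < theta]; the rates are the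
    best admissible values of [al]. *)


(** * Euclidean geometry *)

Section EuclideanGeometry.
Context {R : realType} {n : nat}.
Implicit Types (u v w : 'rV[R]_n) (A : 'M[R]_n).

Lemma dotE u v : dot u v = (u *m v^T) 0 0.
Proof. by rewrite /dot mxE; apply: eq_bigr => i _; rewrite mxE. Qed.

Lemma dotC u v : dot u v = dot v u.
Proof. by rewrite /dot; apply: eq_bigr => i _; rewrite mulrC. Qed.

Lemma dotDl u v w : dot (u + v) w = dot u w + dot v w.
Proof. by rewrite !dotE mulmxDl mxE. Qed.

Lemma dotZl (a : R) u v : dot (a *: u) v = a * dot u v.
Proof. by rewrite !dotE -scalemxAl mxE. Qed.

Lemma dotNl u v : dot (- u) v = - dot u v.
Proof. by rewrite !dotE mulNmx mxE. Qed.

Lemma dotDr u v w : dot w (u + v) = dot w u + dot w v.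
Proof. by rewrite dotC dotDl !(dotC w). Qed.

Lemma dotZr (a : R) u v : dot v (a *: u) = a * dot v u.
Proof. by rewrite dotC dotZl (dotC v). Qed.

Lemma dotNr u v : dot u (- v) = - dot u v.
Proof. by rewrite dotC dotNl dotC. Qed.

Lemma dot0l u : dot 0 u = 0.
Proof. by rewrite dotE mul0mx mxE. Qed.

Lemma dot0r u : dot u 0 = 0.
Proof. by rewrite dotC dot0l. Qed.

Lemma dot_ge0 u : 0 <= dot u u.
Proof. by apply: sumr_ge0 => i _; rewrite -expr2 sqr_ge0. Qed.

Lemma dot_mulmx_sym A u v : A^T = A -> dot (u *m A) v = dot u (v *m A).
Proof. by move=> sA; rewrite !dotE trmx_mul sA mulmxA. Qed.

Lemma possemidef_CS A u v : possemidef A ->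
  dot (u *m A) v ^+ 2 <= dot (u *m A) u * dot (v *m A) v.
Proof.
move=> [sA pA].
have buv : dot (v *m A) u = dot (u *m A) v by rewrite dot_mulmx_sym// dotC.
have quad s t : 0 <= t ^+ 2 * dot (u *m A) u - 2 * t * s * dot (u *m A) v
   + s ^+ 2 * dot (v *m A) v.
  have := pA (t *: u - s *: v).
  rewrite mulmxDl mulNmx -!scalemxAl !(dotDl, dotDr, dotNl, dotNr, dotZl, dotZr).
  by rewrite buv => h; apply: le_trans h _; lra.
have a0 := pA u; have c0 := pA v.
set a := dot (u *m A) u in quad a0 *; set c := dot (v *m A) v in quad c0 *.
set b := dot (u *m A) v in quad *.
have [c_eq0|c_neq0] := eqVneq c 0.
  have := quad (a + 1) b; rewrite c_eq0 !mulr0 addr0 => h.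
  have h2 : 0 <= - (b ^+ 2 * (a + 2)) by apply: le_trans h _; lra.
  have : b ^+ 2 * (a + 2) <= 0 by rewrite -oppr_ge0.
  by rewrite pmulr_lle0//; lra.
have c_gt0 : 0 < c by rewrite lt_neqAle eq_sym c_neq0.
have := quad b c => h.
have h2 : 0 <= c * (a * c - b ^+ 2) by apply: le_trans h _; lra.
by rewrite pmulr_rge0// subr_ge0 in h2.
Qed.

Lemma enorm_ge0 u : 0 <= enorm u.
Proof. exact: sqrtr_ge0. Qed.

Lemma enorm_sqr u : enorm u ^+ 2 = dot u u.
Proof. by rewrite /enorm sqr_sqrtr// dot_ge0. Qed.

Lemma enorm0 : enorm (0 : 'rV[R]_n) = 0.
Proof. by rewrite /enorm dot0l sqrtr0. Qed.

Lemma enormN u : enorm (- u) = enorm u.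
Proof. by rewrite /enorm dotNl dotNr opprK. Qed.

Lemma enormZ (a : R) u : enorm (a *: u) = `|a| * enorm u.
Proof.
by rewrite /enorm dotZl dotZr mulrA -expr2 sqrtrM ?sqr_ge0// sqrtr_sqr.
Qed.

Lemma enorm_distC u v : enorm (u - v) = enorm (v - u).
Proof. by rewrite -enormN opprB. Qed.

Lemma dot_le_enorm u v : `|dot u v| <= enorm u * enorm v.
Proof.
have id_psd : possemidef (1%:M : 'M[R]_n).
  by split=> [|z]; rewrite ?trmx1// mulmx1 dot_ge0.
have := possemidef_CS u v id_psd; rewrite !mulmx1 => h.
rewrite -(@ler_pXn2r _ 2)// ?nnegrE ?mulr_ge0 ?enorm_ge0//.
by rewrite exprMn !enorm_sqr real_normK ?num_real.
Qed.

Lemma enorm_triangle u v : enorm (u + v) <= enorm u + enorm v.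
Proof.
rewrite -(@ler_pXn2r _ 2)// ?nnegrE ?addr_ge0 ?enorm_ge0//.
rewrite enorm_sqr dotDl !dotDr sqrrD !enorm_sqr (dotC v u).
have := ler_norm (dot u v); have := dot_le_enorm u v; lra.
Qed.

Lemma enormB_triangle u v : enorm (u - v) <= enorm u + enorm v.
Proof. by rewrite -(enormN v) enorm_triangle. Qed.

Lemma enorm_dist_triangle u v w : enorm (u - w) <= enorm (u - v) + enorm (v - w).
Proof. by rewrite -{1}(subrK v u) -addrA enorm_triangle. Qed.

Lemma norm_coord_le_enorm u i : `|u 0 i| <= enorm u.
Proof.
rewrite -(@ler_pXn2r _ 2)// ?nnegrE ?enorm_ge0// enorm_sqr real_normK ?num_real//.
rewrite /dot (bigD1 i)//= expr2 lerDl.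
by apply: sumr_ge0 => j _; rewrite -expr2 sqr_ge0.
Qed.

Lemma norm_le_enorm u : `|u| <= enorm u.
Proof.
rewrite [leLHS]/Num.norm /= mx_normrE; apply/bigmax_leP; split.
  exact: enorm_ge0.
by move=> [i j] _ /=; rewrite ord1; exact: norm_coord_le_enorm.
Qed.

Lemma norm_coord_le_norm u i : `|u 0 i| <= `|u|.
Proof.
rewrite [leRHS]/Num.norm /= mx_normrE.
exact: (le_bigmax _ (fun ij : 'I_1 * 'I_n => `|u ij.1 ij.2|) (0, i)).
Qed.

Lemma enorm_le_norm u : enorm u <= n%:R * `|u|.
Proof.
rewrite -(@ler_pXn2r _ 2)// ?nnegrE ?mulr_ge0 ?enorm_ge0// enorm_sqr exprMn.
apply: (@le_trans _ _ (\sum_(i < n) `|u| ^+ 2)).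
  apply: ler_sum => i _; rewrite -expr2 -(real_normK (num_real (u 0 i))).
  by rewrite ler_pXn2r ?nnegrE// norm_coord_le_norm.
rewrite sumr_const card_ord -[leLHS]mulr_natl ler_wpM2r ?sqr_ge0//.
by rewrite -natrX ler_nat; case: (n) => // m; rewrite -mulnn leq_pmulr.
Qed.

Lemma enorm_eq0 u : enorm u = 0 -> u = 0.
Proof.
by move=> u0; apply/eqP; rewrite -normr_le0 -{1}u0 norm_le_enorm.
Qed.

(** Convexity is not needed: a global affine minorant touching [phi] at a point
    of differentiability has the slope of [phi]. *)
Lemma loewner_ge_dot A (a : R) u : loewner_le a%:M A ->
  a * enorm u ^+ 2 <= dot (u *m A) u.
Proof.
move=> [_ /(_ u)]; rewrite mulmxBr dotDl dotNl mul_mx_scalar dotZl subr_ge0.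
by rewrite enorm_sqr.
Qed.

Lemma loewner_le_dot A (a : R) u : loewner_le A a%:M ->
  dot (u *m A) u <= a * enorm u ^+ 2.
Proof.
move=> [_ /(_ u)]; rewrite mulmxBr dotDl dotNl mul_mx_scalar dotZl subr_ge0.
by rewrite enorm_sqr.
Qed.

(** Cauchy-Schwarz for the form of [A], applied to [u] and [u *m A], bounds the
    operator norm of a positive semidefinite matrix by its Loewner bound. *)
Lemma enorm_mulmx_le A (a : R) u : possemidef A -> 0 <= a ->
  loewner_le A a%:M -> enorm (u *m A) <= a * enorm u.
Proof.
move=> pA a0 Aa; set v := u *m A.
have := possemidef_CS u v pA; rewrite -/v -enorm_sqr => CS.
have h1 := loewner_le_dot u Aa; have h2 := loewner_le_dot v Aa.
have [/eqP v0|v0] := eqVneq (enorm v) 0.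
  by rewrite (eqP v0) mulr_ge0// enorm_ge0.
have v_gt0 : 0 < enorm v by rewrite lt_neqAle eq_sym v0 enorm_ge0.
rewrite -(@ler_pXn2r _ 2)// ?nnegrE ?mulr_ge0 ?enorm_ge0//.
rewrite -(ler_pM2r (exprn_gt0 2 v_gt0)).
apply: (@le_trans _ _ ((a * enorm u ^+ 2) * (a * enorm v ^+ 2))); last first.
  by rewrite exprMn expr2 -expr2; lra.
by rewrite -expr2; apply: le_trans CS (ler_pM (pA.2 u) (pA.2 v) h1 h2).
Qed.

End EuclideanGeometry.

(** * Gradients *)

Section Gradients.
Context {R : realType} {n : nat}.
Implicit Types (u v x z : 'rV[R]_n) (phi : 'rV[R]_n -> R).

Lemma derive_gradient phi x v : differentiable (phi : 'rV[R]_n -> R^o) x ->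
  'D_v (phi : 'rV[R]_n -> R^o) x = dot (gradient phi x) v.
Proof.
move=> dphi; rewrite deriveE// [in LHS](row_sum_delta v) linear_sum /dot.
by apply: eq_bigr => i _; rewrite linearZ mxE deriveE// mulrC.
Qed.

Lemma gradient_approx phi x (e : R) :
  differentiable (phi : 'rV[R]_n -> R^o) x -> 0 < e ->
  \forall z \near x,
    `|phi z - phi x - dot (gradient phi x) (z - x)| <= e * enorm (z - x).
Proof.
move=> dphi e0.
have /eqaddoP /(_ e e0) := diff_locally dphi.
move=> approx; apply/nbhs0P; apply: filterS approx => v.
rewrite -[leLHS]/(`|phi (v + x) - (phi x + 'd (phi : _ -> R^o) x v)|).
rewrite -deriveE// derive_gradient// [x + v]addrC addrK opprD addrA => /le_trans.
by apply; rewrite ler_wpM2l ?(ltW e0)// norm_le_enorm.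
Qed.

(** A one-dimensional restriction has the directional derivative as slope. *)
Lemma is_derive_line phi x v (t : R) :
  differentiable (phi : 'rV[R]_n -> R^o) (x + t *: v) ->
  is_derive t 1 ((fun s => phi (x + s *: v)) : R^o -> R^o)
    (dot (gradient phi (x + t *: v)) v).
Proof.
move=> dphi.
have E : (fun h : R => h^-1 *: (((fun s => phi (x + s *: v) : R^o) \o shift t)
      (h *: 1) - (phi (x + t *: v) : R^o)))
  = (fun h => h^-1 *: (((phi : _ -> R^o) \o shift (x + t *: v)) (h *: v)
      - (phi (x + t *: v) : R^o))).
  apply/funext => s /=; congr (_ *: (phi _ - _)).
  by rewrite /shift /= scalerDl [s%:A]mulr1 addrCA.
have := diff_derivable (v := v) dphi; rewrite /derivable -E => D.
apply: DeriveDef => //.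
by rewrite -derive_gradient// /derive E.
Qed.

Lemma descent_lemma phi (L : R) x z :
  (forall u, differentiable (phi : 'rV[R]_n -> R^o) u) ->
  (forall u v, enorm (gradient phi u - gradient phi v) <= L * enorm (u - v)) ->
  phi z <= phi x + dot (gradient phi x) (z - x) + L / 2 * enorm (z - x) ^+ 2.
Proof.
move=> dphi Lphi; set v := z - x.
pose a := dot (gradient phi x) v; pose b := L / 2 * enorm v ^+ 2.
pose psi (t : R) : R := phi (x + t *: v) - (t * a + t ^+ 2 * b).
pose dpsi (t : R) : R := dot (gradient phi (x + t *: v)) v - (a + 2 * t * b).
have D (t : R) : is_derive t 1 (psi : R^o -> R^o) (dpsi t).
  have d1 := is_derive_line (dphi (x + t *: v)).
  have d2 : is_derive t 1 ((fun t => t * a + t ^+ 2 * b) : R^o -> R^o)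
      (a + 2 * t * b).
    have -> : (fun t => t * a + t ^+ 2 * b) = horner (a *: 'X + b *: 'X^2).
      by apply/funext => s; rewrite hornerD !hornerZ hornerX hornerXn; ring.
    apply: is_derive_eq; rewrite derivD !derivZ derivX derivXn.
    rewrite hornerD !hornerZ hornerC hornerMn hornerXn expr1.
    by ring.
  exact: (is_deriveB d1 d2).
have [|c c01] := @MVT_segment R psi dpsi 0 1 ler01.
  apply: derivable_within_continuous => t _.
  by have [] := D t.
have c0 : 0 <= c by move: c01; rewrite in_itv => /andP[].
have dpsi_le0 : dpsi c <= 0.
  have := ler_norm (dot (gradient phi (x + c *: v) - gradient phi x) v).
  have := dot_le_enorm (gradient phi (x + c *: v) - gradient phi x) v.
  have := Lphi (x + c *: v) x.
  rewrite [x + _ - x]addrAC subrr add0r enormZ ger0_norm// => h1 h2 h3.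
  have h4 := ler_wpM2r (enorm_ge0 v) h1.
  move: h2 h3 h4; rewrite /dpsi /a /b dotDl dotNl; lra.
rewrite subr0 mulr1 => E.
have : psi 1 <= psi 0 by rewrite -subr_le0 E.
have xv : x + v = z by rewrite /v addrC subrK.
rewrite /psi scale1r scale0r addr0 xv expr1n expr0n/= !mul0r !mul1r.
rewrite -/a -/b; lra.
Qed.

Lemma nbhs_ray x v (P : set 'rV[R]_n) : nbhs x P ->
  exists2 t : R, 0 < t & P (x + t *: v).
Proof.
move=> /nbhs_normP[r /= r0 rP]; exists (r / 2 / (`|v| + 1)).
  by rewrite !divr_gt0// ltr_wpDl.
apply: rP => /=; rewrite opprD addNKr normrN normrZ ger0_norm; last first.
  by rewrite !divr_ge0 ?addr_ge0// ltW.
have v1 : 0 < `|v| + 1 by rewrite ltr_wpDl.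
rewrite mulrAC ltr_pdivrMr// ltr_pM// ?divr_ge0 ?(ltW r0)//.
  by rewrite ltr_pdivrMr//; lra.
by rewrite ltrDl.
Qed.

Lemma subgradient_eq_gradient phi x d :
  differentiable (phi : 'rV[R]_n -> R^o) x ->
  eps_subdiff (EFin \o phi) 0 x d -> d = gradient phi x.
Proof.
move=> dphi dd; apply/eqP; rewrite -subr_eq0; apply/eqP.
set v := d - gradient phi x; apply/enorm_eq0/eqP; apply: contraT => v0.
have v_gt0 : 0 < enorm v by rewrite lt_neqAle eq_sym v0 enorm_ge0.
have v2 : 0 < enorm v / 2 by rewrite divr_gt0.
have [t t0 /=] := nbhs_ray v (gradient_approx dphi v2).
have := dd (x + t *: v); rewrite /= sube0 -EFinD lee_fin.
rewrite [x + _ - x]addrAC subrr add0r enormZ (ger0_norm (ltW t0)).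
set p := phi _ => h1 h2.
have := ler_normlW h2; rewrite -subr_ge0 in h1.
have : t * enorm v ^+ 2 = dot d (t *: v) - dot (gradient phi x) (t *: v).
  by rewrite enorm_sqr {1}/v dotDl dotNl !dotZr; ring.
have : 0 < t * enorm v ^+ 2 by rewrite mulr_gt0// exprn_gt0.
have : enorm v / 2 * (t * enorm v) = t * enorm v ^+ 2 / 2 by field.
move: h1; lra.
Qed.

End Gradients.

(** * Powers and elementary recursions *)

Section Recursions.
Context {R : realType}.
Implicit Types (a b d e r s u x C M : R).

Lemma weighted_AMGM r s (t : R) : 0 <= r -> 0 <= s -> 0 < t < 1 ->
  r `^ t * s `^ (1 - t) <= t * r + (1 - t) * s.
Proof.
move=> r0 s0 /andP[t0 t1]; have t1' : 0 < 1 - t by rewrite subr_gt0.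
have tt : t + (1 - t) = 1 by rewrite addrC subrK.
have := @conjugate_powR R (r `^ t) (s `^ (1 - t)) t^-1 (1 - t)^-1.
rewrite !invr_gt0 !powR_ge0 !invrK -!powRrM !divff ?gt_eqF// !powRr1// => h.
by apply: le_trans (h _ _ _ _ tt) _ => //; rewrite mulrC (mulrC s).
Qed.

(** Concavity of the power [1 - t], cleared of denominators so that it also
    holds at [r = 0]. *)
Lemma powR_concave_slope r s (t : R) : 0 <= r -> 0 <= s -> 0 < t < 1 ->
  (1 - t) * (r - s) <= r `^ t * (r `^ (1 - t) - s `^ (1 - t)).
Proof.
move=> r0 s0 t01; have := weighted_AMGM r0 s0 t01.
have -> : r `^ t * (r `^ (1 - t) - s `^ (1 - t)) = r - r `^ t * s `^ (1 - t).
  have tt : t + (1 - t) = 1 by rewrite addrC subrK.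
  by rewrite mulrBr -powRD tt ?oner_eq0// powRr1.
lra.
Qed.

(** One step of the length estimate: the decrease [a * d' ^+ 2] is converted by
    concavity into a bound on [d'] through the geometric mean of [d + e] and of
    the decrease of [r `^ (1 - t)]. *)
Lemma one_step_length (t a C d d' e r r' : R) :
  0 < t < 1 -> 0 < a -> 0 < C -> 0 <= d -> 0 <= d' -> 0 <= e -> 0 <= r' ->
  a * d' ^+ 2 <= r - r' -> r `^ t <= C * (d + e) ->
  2 * d' <= d + e + C / (a * (1 - t)) * (r `^ (1 - t) - r' `^ (1 - t)).
Proof.
move=> t01 a0 C0 d0 d'0 e0 r'0 desc klr.
have t1' : 0 < 1 - t by move: t01 => /andP[]; lra.
have rr' : r' <= r.
  by rewrite -subr_ge0; apply: le_trans desc; rewrite mulr_ge0 ?sqr_ge0 ?ltW.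
set D := r `^ (1 - t) - r' `^ (1 - t); set M := C / _.
have D0 : 0 <= D.
  by rewrite subr_ge0 ge0_ler_powR ?nnegrE ?(ltW t1')// (le_trans r'0).
have M0 : 0 < M by rewrite divr_gt0// mulr_gt0.
have h1 := powR_concave_slope (le_trans r'0 rr') r'0 t01.
rewrite -/D in h1.
have h2 : r `^ t * D <= C * (d + e) * D by rewrite ler_wpM2r.
have h3 : (1 - t) * (a * d' ^+ 2) <= C * (d + e) * D.
  apply: le_trans (ler_wpM2l (ltW t1') desc) _; exact: le_trans h1 h2.
have h4 : d' ^+ 2 <= (d + e) * (M * D).
  have -> : (d + e) * (M * D) = C * (d + e) * D / (a * (1 - t)).
    by rewrite /M; field; rewrite !gt_eqF.
  by rewrite ler_pdivlMr ?mulr_gt0//; lra.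
have MD : 0 <= M * D by rewrite mulr_ge0// ltW.
rewrite -(@ler_pXn2r _ 2)// ?nnegrE ?mulr_ge0 ?addr_ge0//.
have := sqr_ge0 (d + e - M * D); move: h4; rewrite !expr2; nra.
Qed.

Lemma powRN_le x y b : 0 <= b -> 0 < x -> x <= y -> y `^ (- b) <= x `^ (- b).
Proof.
move=> b0 x0 xy; have y0 := lt_le_trans x0 xy.
by rewrite !powRN lef_pV2 ?posrE ?powR_gt0// ge0_ler_powR// ?nnegrE ltW.
Qed.

Lemma powRN_div x y b : 0 <= x -> 0 < y -> (x / y) `^ (- b) = x `^ (- b) * y `^ b.
Proof.
move=> x0 y0; rewrite powRM ?invr_ge0 ?(ltW y0)//; congr (_ * _).
by rewrite -powR_inv1 ?(ltW y0)// -powRrM mulN1r opprK.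
Qed.

Lemma ln_le_subr1 s : 0 < s -> ln s <= s - 1.
Proof.
move=> s0; have -> : ln s = ln (1 + (s - 1)) by rewrite addrC subrK.
by apply: le_ln1Dx; lra.
Qed.

Lemma powRN_tangent s b : 0 < s -> 0 <= b -> 1 + b * (1 - s) <= s `^ (- b).
Proof.
move=> s0 b0; rewrite /powR gt_eqF//.
apply: le_trans (expR_ge1Dx _); rewrite lerD2l mulNr -mulrN ler_wpM2l//.
by have := ln_le_subr1 s0; lra.
Qed.

(** The next two lemmas compare the increments of [x `^ (- b)] with its
    derivative. *)
Lemma powR_diff_ge x b : 0 < x -> 0 < b ->
  b * (x + 1) `^ (- (1 + b)) <= x `^ (- b) - (x + 1) `^ (- b).
Proof.
move=> x0 b0; have y0 : 0 < x + 1 by lra.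
have := powRN_tangent (divr_gt0 x0 y0) (ltW b0).
rewrite powRN_div ?(ltW x0)// => h.
have yb : 0 < (x + 1) `^ (- b) by rewrite powR_gt0.
have := ler_wpM2l (ltW yb) h; rewrite mulrCA -powRD; last first.
  by apply/implyP => _; rewrite gt_eqF.
rewrite addNr powRr0 mulr1 opprD powRD; last by apply/implyP => _; rewrite gt_eqF.
rewrite powR_inv1 ?(ltW y0)//.
have -> : 1 - x / (x + 1) = (x + 1)^-1 by field; rewrite gt_eqF.
lra.
Qed.

Lemma powR_diff_le x b : 0 < x -> 0 < b ->
  x `^ (- b) - (x + 1) `^ (- b) <= b * x `^ (- (1 + b)).
Proof.
move=> x0 b0; have y0 : 0 < x + 1 by lra.
have := powRN_tangent (divr_gt0 y0 x0) (ltW b0).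
rewrite powRN_div ?(ltW y0)// => h.
have xb : 0 < x `^ (- b) by rewrite powR_gt0.
have := ler_wpM2l (ltW xb) h; rewrite mulrCA -powRD; last first.
  by apply/implyP => _; rewrite gt_eqF.
rewrite addNr powRr0 mulr1 opprD powRD; last by apply/implyP => _; rewrite gt_eqF.
rewrite powR_inv1 ?(ltW x0)//.
have -> : 1 - (x + 1) / x = - x^-1 by field; rewrite gt_eqF.
lra.
Qed.

Lemma powRN_half x y b : 0 <= b -> 0 < y -> y <= 2 * x ->
  x `^ (- b) <= 2 `^ b * y `^ (- b).
Proof.
move=> b0 y0 yx; rewrite mulrC -powRN_div ?(ltW y0)//.
by apply: powRN_le => //; [rewrite divr_gt0|rewrite ler_pdivrMr// mulrC].
Qed.

Lemma powR_add3_le (p u v w : R) : 0 <= p -> 0 <= u -> 0 <= v -> 0 <= w ->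
  (u + v + w) `^ p <= 3 `^ p * (u `^ p + v `^ p + w `^ p).
Proof.
move=> p0 u0 v0 w0; pose m := Num.max u (Num.max v w).
have m0 : 0 <= m by rewrite le_max u0.
have um : u <= m by rewrite le_max lexx.
have vm : v <= m by rewrite !le_max lexx orbT.
have wm : w <= m by rewrite !le_max lexx !orbT.
apply: (@le_trans _ _ ((3 * m) `^ p)).
  by rewrite ge0_ler_powR ?nnegrE ?addr_ge0 ?mulr_ge0//; lra.
rewrite powRM// ler_wpM2l ?powR_ge0// /m.
have := powR_ge0 u p; have := powR_ge0 v p; have := powR_ge0 w p => h1 h2 h3.
by case: (leP v w) => _; [case: (leP u w)|case: (leP u v)] => _; lra.
Qed.

Lemma geometric_le_power (w b : R) : 0 < w < 1 -> 0 < b ->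
  exists2 C : R, 0 < C & forall k : nat, w ^+ k <= C * k.+1%:R `^ (- b).
Proof.
move=> /andP[w0 w1] b0; have l0 : 0 < - ln w by rewrite oppr_gt0 ln_lt0// w0.
set l := - ln w in l0; have c0 : 0 < l / b by rewrite divr_gt0.
exists (expR (l - b - b * ln (l / b))) => [|k]; first exact: expR_gt0.
have k0 : 0 < k.+1%:R :> R by rewrite ltr0n.
have wk : w ^+ k = expR (- (k%:R * l)).
  by rewrite -mulrN expRM_natl /l opprK lnK ?posrE.
rewrite wk /powR gt_eqF// -expRD ler_expR.
(* The tangent of ln at b / l bounds b * ln k.+1 by l * k.+1 plus a constant. *)
have := ln_le_subr1 (mulr_gt0 k0 c0).
rewrite lnM ?posrE// => h; have := ler_wpM2l (ltW b0) h.
have -> : b * (k.+1%:R * (l / b) - 1) = k.+1%:R * l - b by field; rewrite gt_eqF.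
rewrite -[in leRHS]natr1; lra.
Qed.

(** The function [A * k `^ (- al)] is a supersolution of the recursion when [A] is
    large: its increments are of the order [A], the left-hand side of the order
    [A `^ (1 + al^-1)]. *)
Lemma power_rate_of_recursion (u : nat -> R) (al C : R) (K : nat) :
  0 < al -> 0 < C -> (forall k, 0 <= u k) ->
  (forall k, (K <= k)%N -> u k.+1 `^ ((1 + al) / al) <=
     C * (u k - u k.+1) + C * k.+1%:R `^ (- (1 + al))) ->
  exists2 A : R, 0 < A & forall k, (K < k)%N -> u k <= A * k%:R `^ (- al).
Proof.
move=> al0 C0 u0 rec.
(* The factor 2 `^ (1 + al) pays for comparing k with k.+1. *)
pose c := al * 2 `^ (1 + al) + 1.
have c0 : 0 < c by rewrite ltr_wpDl// mulr_ge0 ?powR_ge0// ltW.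
pose A := (C * c) `^ al + 1 + u K.+1 * K.+1%:R `^ al.
have A1 : 1 <= A.
  by rewrite /A addrAC lerDr addr_ge0 ?powR_ge0// mulr_ge0 ?powR_ge0.
have A0 : 0 < A by apply: lt_le_trans A1.
have AC : C * c <= A `^ al^-1.
  have Cc : 0 <= C * c by rewrite mulr_ge0// ltW.
  have {1}-> : C * c = ((C * c) `^ al) `^ al^-1.
    by rewrite -powRrM divff ?gt_eqF// powRr1.
  rewrite ge0_ler_powR ?invr_ge0 ?nnegrE ?powR_ge0 ?(ltW al0) ?(ltW A0)//.
  by rewrite /A -addrA lerDl addr_ge0// mulr_ge0 ?powR_ge0.
have AuK : u K.+1 <= A * K.+1%:R `^ (- al).
  rewrite powRN ler_pdivlMr ?powR_gt0 ?ltr0n// /A lerDr addr_ge0//.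
  exact: powR_ge0.
exists A => //; elim=> // k IH; rewrite ltnS leq_eqVlt => /orP[/eqP <-//|Kk].
have k0 : 0 < k%:R :> R by rewrite ltr0n (leq_ltn_trans _ Kk).
have k1 : 1 <= k%:R :> R by rewrite ler1n (leq_ltn_trans _ Kk).
have y0 : 0 < k.+1%:R :> R by rewrite ltr0n.
rewrite leNgt; apply/negP => contra.
have Ay0 : 0 <= A * k.+1%:R `^ (- al) by rewrite mulr_ge0 ?powR_ge0// ltW.
set Y := k.+1%:R `^ (- (1 + al)) in rec *.
have Y0 : 0 < Y by rewrite powR_gt0.
have lower : A * A `^ al^-1 * Y < u k.+1 `^ ((1 + al) / al).
  have p0 : 0 < (1 + al) / al by rewrite divr_gt0// addr_gt0.
  apply: le_lt_trans (gt0_ltr_powR p0 _ _ contra); rewrite ?nnegrE ?u0//.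
  rewrite powRM ?(ltW A0) ?powR_ge0// -powRrM.
  have -> : - al * ((1 + al) / al) = - (1 + al) by field; rewrite gt_eqF.
  have -> : (1 + al) / al = 1 + al^-1 by field; rewrite gt_eqF.
  rewrite powRD; last by apply/implyP => _; rewrite gt_eqF.
  by rewrite powRr1 ?(ltW A0).
have upper : u k.+1 `^ ((1 + al) / al) <= C * c * A * Y.
  apply: le_trans (rec _ (ltnW Kk)) _; rewrite -/Y.
  have diff := powR_diff_le k0 al0; rewrite natr1 in diff.
  have half : k%:R `^ (- (1 + al)) <= 2 `^ (1 + al) * Y.
    by apply: powRN_half => //; [lra|rewrite -natr1; lra].
  have h1 : u k - u k.+1 <= A * (al * (2 `^ (1 + al) * Y)).
    have h2 := ler_wpM2l (ltW al0) half.
    have h3 := ler_wpM2l (ltW A0) (le_trans diff h2).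
    by have h4 := IH Kk; move: h3 h4 (ltW contra); rewrite mulrBr; lra.
  have h2 := ler_wpM2l (ltW C0) h1.
  have h3 : C * Y <= C * A * Y.
    by rewrite -mulrA ler_wpM2l ?(ltW C0)// ler_peMl// ltW.
  by rewrite /c; lra.
have := lt_le_trans lower upper.
rewrite ltr_pM2r// [X in _ < X]mulrC ltr_pM2l// => /lt_le_trans /(_ AC).
by rewrite ltxx.
Qed.

Lemma linear_rate_of_recursion (u : nat -> R) (w C : R) (K : nat) :
  0 < w < 1 -> 0 < C -> (forall k, 0 <= u k) ->
  (forall k, (K <= k)%N -> u k.+1 <= C * (u k - u k.+1) + C * w ^+ k) ->
  exists2 rho : R, 0 < rho < 1 &
    exists2 A : R, 0 < A & forall k, (K <= k)%N -> u k <= A * rho ^+ k.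
Proof.
move=> /andP[w0 w1] C0 u0 rec.
(* The recursion contracts by C / (1 + C); any larger ratio absorbs the
   perturbation. *)
pose rho := Num.max w ((2 * C + 1) / (2 * C + 2)).
have s0 : 0 < 2 * C + 2 by lra.
have rho0 : 0 < rho by rewrite lt_max w0.
have rho1 : rho < 1 by rewrite gt_max w1 ltr_pdivrMr//=; lra.
have wrho : w <= rho by rewrite le_max lexx.
have Crho : 2 * C + 1 <= rho * (2 * C + 2).
  by rewrite -ler_pdivrMr// le_max lexx orbT.
exists rho; rewrite ?rho0//.
pose A := 2 * C / rho + u K / rho ^+ K + 1.
have rK : 0 < rho ^+ K by rewrite exprn_gt0.
have uK : 0 <= u K / rho ^+ K by rewrite divr_ge0// ltW.
have Cr0 : 0 < 2 * C / rho by rewrite divr_gt0// mulr_gt0.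
have A0 : 0 < A by rewrite /A; lra.
exists A => // k; elim: k => [|k IH]; rewrite leq_eqVlt => /orP[/eqP Kk|Kk].
- rewrite -Kk -ler_pdivrMr//; first by rewrite /A; lra.
- by [].
- by rewrite -Kk -ler_pdivrMr//; rewrite /A; lra.
have rk : 0 < rho ^+ k by rewrite exprn_gt0.
have hk := IH Kk; have := rec _ Kk; have wk : w ^+ k <= rho ^+ k.
  by rewrite lerXn2r// nnegrE ltW.
have h1 := ler_wpM2l (ltW C0) hk; have h2 := ler_wpM2l (ltW C0) wk => h3.
have h4 : (1 + C) * u k.+1 <= C * (A + 1) * rho ^+ k by lra.
have h5 : C * (A + 1) <= (1 + C) * (A * rho).
  have : A * (2 * C + 1) <= A * (rho * (2 * C + 2)) by rewrite ler_pM2l.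
  have : 2 * C <= A.
    have : 2 * C <= 2 * C / rho.
      by rewrite ler_pdivlMr// ler_piMr ?(ltW rho1)//; lra.
    by rewrite /A; lra.
  lra.
have := ler_wpM2r (ltW rk) h5 => h6.
rewrite exprS -(@ler_pM2l _ (1 + C)); last by lra.
by apply: le_trans h4 _; apply: le_trans h6 _; rewrite -!mulrA.
Qed.

End Recursions.

(** * Series and trajectories of finite length *)

Section Tails.
Context {R : realType}.
Implicit Types (u e : nat -> R).

(** For a nonnegative sequence this is summability. *)
Definition bounded_sums u := exists B : R, forall N, \sum_(0 <= k < N) u k <= B.

Lemma sum_nat_ge0 u m N : (forall k, 0 <= u k) -> 0 <= \sum_(m <= k < N) u k.
Proof. by move=> u0; apply: sumr_ge0. Qed.

Lemma sum_nat_mono u m N N' : (forall k, 0 <= u k) -> (N <= N')%N ->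
  \sum_(m <= k < N) u k <= \sum_(m <= k < N') u k.
Proof.
move=> u0 NN'; have [mN|/ltnW Nm] := leqP m N; last first.
  by rewrite big_geq// sum_nat_ge0.
by rewrite (big_cat_nat mN NN')/= lerDl sum_nat_ge0.
Qed.

(** The sum of a nonnegative sequence with bounded partial sums, through its
    remainders. *)
Lemma remainder_exists u : (forall k, 0 <= u k) -> bounded_sums u ->
  exists T : nat -> R, [/\ forall k, 0 <= T k,
    forall k, T k - T k.+1 = u k &
    forall m b, (forall N, \sum_(m <= k < N) u k <= b) -> T m <= b].
Proof.
move=> u0 [B uB]; pose P N := \sum_(0 <= k < N) u k.
pose S := sup (range P).
have hS : has_sup (range P).
  by split; [exists (P 0%N), 0%N|exists B => _ [N _ <-]; exact: uB].
exists (fun k => S - P k); split=> [k|k|m b mb].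
- by rewrite subr_ge0; apply: (ub_le_sup hS.2); exists k.
- by rewrite /P big_nat_recr//=; ring.
- rewrite lerBlDr; apply: ge_sup; first exact: hS.1.
  move=> _ [N _ <-]; have [Nm|/ltnW mN] := leqP N m.
    apply: le_trans (sum_nat_mono 0 u0 Nm) _; rewrite lerDr.
    by apply: le_trans (mb 0%N); rewrite sum_nat_ge0.
  by rewrite /P (big_cat_nat (leq0n m) mN)/= addrC lerD2r.
Qed.

Lemma remainder_sum u (T : nat -> R) m N : (m <= N)%N ->
  (forall k, T k - T k.+1 = u k) -> \sum_(m <= k < N) u k = T m - T N.
Proof.
move=> mN Tu; elim: N mN => [|N IH].
  by rewrite leqn0 => /eqP ->; rewrite big_geq// subrr.
rewrite leq_eqVlt => /orP[/eqP <-|mN]; first by rewrite big_geq// subrr.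
by rewrite big_nat_recr//= IH// -Tu; ring.
Qed.

Lemma sum_le_telescope (u b : nat -> R) m N :
  (forall k, 0 <= b k) -> (forall k, (m <= k)%N -> u k <= b k - b k.+1) ->
  \sum_(m <= k < N) u k <= b m.
Proof.
move=> b0 ub; have [mN|/ltnW Nm] := leqP m N; last by rewrite big_geq.
have : \sum_(m <= k < N) u k <= b m - b N.
  rewrite -(remainder_sum mN (fun k => erefl (b k - b k.+1))).
  by rewrite big_nat_cond [leRHS]big_nat_cond ler_sum// => k /andP[/andP[/ub]].
by have := b0 N; lra.
Qed.

Lemma bounded_sums_tail u (eta : R) : (forall k, 0 <= u k) -> bounded_sums u ->
  0 < eta -> \forall m \near \oo, forall N, \sum_(m <= k < N) u k <= eta.
Proof.
move=> u0 ub eta0; have [T [T0 Tu Tmin]] := remainder_exists u0 ub.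
have mono m m' : (m <= m')%N -> T m' <= T m.
  by move=> mm'; rewrite -subr_ge0 -(remainder_sum mm' Tu) sum_nat_ge0.
have [M TM] : exists M, T M <= eta.
  apply: contrapT => /forallNP h.
  have : T 0%N <= T 0%N - eta.
    apply: Tmin => N; rewrite (remainder_sum (leq0n N) Tu) lerD2l lerN2.
    by have /negP := h N; rewrite -ltNge => /ltW.
  by rewrite lerDl oppr_ge0 leNgt eta0.
exists M => // m /= Mm N; apply: le_trans (le_trans (mono _ _ Mm) TM).
have [mN|/ltnW Nm] := leqP m N; last by rewrite big_geq.
by rewrite (remainder_sum mN Tu) gerBl.
Qed.

Lemma bounded_sumsD u e : bounded_sums u -> bounded_sums e ->
  bounded_sums (fun k => u k + e k).
Proof.
by move=> [B uB] [B' eB]; exists (B + B') => N; rewrite big_split/= lerD.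
Qed.

Lemma bounded_sums_le u e K : (forall k, 0 <= u k) ->
  (forall k, 0 <= e k) ->
  (forall k, (K <= k)%N -> u k <= e k) -> bounded_sums e -> bounded_sums u.
Proof.
move=> u0 e0 ue [B eB]; exists (\sum_(0 <= k < K) u k + B) => N.
have [NK|/ltnW KN] := leqP N K.
  apply: le_trans (sum_nat_mono 0 u0 NK) _; rewrite lerDl.
  by apply: le_trans (eB 0%N); rewrite big_geq.
rewrite (big_cat_nat (leq0n K) KN)/= lerD2l; apply: le_trans (eB N).
rewrite [leRHS](big_cat_nat (leq0n K) KN)/= ler_wpDl ?sum_nat_ge0//.
by rewrite big_nat_cond [leRHS]big_nat_cond ler_sum// => k /andP[/andP[/ue]].
Qed.

End Tails.

Section RealTails.
Context {R : realType}.
Implicit Type u : nat -> R.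

Lemma bounded_sums_ereal u : (forall k, 0 <= u k) ->
  (\sum_(0 <= k <oo) (u k)%:E < +oo)%E -> bounded_sums u.
Proof.
move=> u0 uoo; exists (fine (\sum_(0 <= k <oo) (u k)%:E)%E) => N.
have u0' k : (0 <= (u k)%:E)%E by rewrite lee_fin.
rewrite -lee_fin fineK.
  by rewrite -sumEFin; apply: nneseries_lim_ge => k _ _; exact: u0'.
by rewrite ge0_fin_numE// nneseries_ge0.
Qed.

Lemma real_tails u : (forall k, 0 <= u k) ->
  (\sum_(0 <= k <oo) (u k)%:E < +oo)%E ->
  exists E : nat -> R, [/\ forall k, 0 <= E k, forall k, E k - E k.+1 = u k,
    E @ \oo --> 0 & forall k, (\sum_(k <= i <oo) (u i)%:E)%E = (E k)%:E].
Proof.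
move=> u0 uoo; pose tail k := (\sum_(k <= i <oo) (u i)%:E)%E.
have u0' k : (0 <= (u k)%:E)%E by rewrite lee_fin.
have tail0 k : (0 <= tail k)%E by apply: nneseries_ge0.
have tail_fin k : tail k \is a fin_num.
  rewrite ge0_fin_numE//; apply: le_lt_trans uoo.
  by rewrite (nneseries_split 0%N k)// add0n leeDr// sume_ge0.
have tailE k : tail k = (fine (tail k))%:E by rewrite fineK.
exists (fine \o tail); split=> [k|k||k] /=; last exact: tailE.
- by rewrite fine_ge0.
- apply: EFin_inj; rewrite EFinB !fineK// {1}/tail (nneseries_split k 1)//.
  by rewrite addn1 big_nat1 -/(tail k.+1) addeK.
- by apply: fine_cvg; exact: nneseries_tail_cvg.
Qed.

End RealTails.

(** In this section [d k] is the length of a step, [r] a merit function whose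
    decrease dominates [d k ^+ 2], and [e] an error sequence; [t] is the exponent
    of a Kurdyka-Lojasiewicz inequality. *)
Section Length.
Context {R : realType} {n : nat}.
Context (t a C : R) (x : nat -> 'rV[R]_n) (r e : nat -> R).
Let d k := enorm (x k.+1 - x k).
Hypotheses (t01 : 0 < t < 1) (a0 : 0 < a) (C0 : 0 < C).
Hypotheses (e0 : forall k, 0 <= e k) (r0 : forall k, 0 <= r k).
Hypothesis descent : forall k, a * d k ^+ 2 <= r k - r k.+1.

Let M := C / (a * (1 - t)).

Let d0 k : 0 <= d k. Proof. exact: enorm_ge0. Qed.

Let M0 : 0 < M.
Proof. by rewrite divr_gt0// mulr_gt0// subr_gt0; case/andP: t01. Qed.

(** As long as the inequality [r k.+1 `^ t <= C * (d k + e k)] holds, the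
    one-step estimates telescope. *)
Lemma length_le m N : (m <= N)%N ->
  (forall k, (m <= k < N)%N -> r k.+1 `^ t <= C * (d k + e k)) ->
  \sum_(m.+1 <= k < N.+1) d k + d N <=
    d m + \sum_(m <= k < N) e k + M * (r m.+1 `^ (1 - t) - r N.+1 `^ (1 - t)).
Proof.
elim: N => [|N IH].
  by rewrite leqn0 => /eqP -> _; rewrite !big_geq// add0r addr0 subrr mulr0 addr0.
rewrite leq_eqVlt => /orP[/eqP <- _|mN kl].
  by rewrite !big_geq// add0r addr0 subrr mulr0 addr0.
rewrite big_nat_recr//= [X in _ <= _ + X + _]big_nat_recr//=.
have klN : r N.+1 `^ t <= C * (d N + e N) by apply: kl; rewrite -ltnS mN ltnSn.
have := one_step_length t01 a0 C0 (d0 N) (d0 N.+1) (e0 N) (r0 N.+2)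
  (descent N.+1) klN.
rewrite -/M; have : \sum_(m.+1 <= k < N.+1) d k + d N <=
  d m + \sum_(m <= k < N) e k + M * (r m.+1 `^ (1 - t) - r N.+1 `^ (1 - t)).
  by apply: (IH mN) => k /andP[mk kN]; apply: kl; rewrite mk ltnW.
rewrite !mulrBr; lra.
Qed.

Lemma length_le_simple m N : (m <= N)%N ->
  (forall k, (m <= k < N)%N -> r k.+1 `^ t <= C * (d k + e k)) ->
  \sum_(m.+1 <= k < N.+1) d k <=
    d m + \sum_(m <= k < N) e k + M * r m.+1 `^ (1 - t).
Proof.
move=> mN /(length_le mN); rewrite mulrBr.
have := mulr_ge0 (ltW M0) (powR_ge0 (r N.+1) (1 - t)); have := d0 N; lra.
Qed.

Lemma enorm_le_length m N : (m <= N)%N ->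
  enorm (x N - x m) <= \sum_(m <= k < N) d k.
Proof.
elim: N => [|N IH].
  by rewrite leqn0 => /eqP ->; rewrite subrr enorm0 big_geq.
rewrite leq_eqVlt => /orP[/eqP <-|mN]; first by rewrite subrr enorm0 big_geq.
rewrite big_nat_recr//= addrC; apply: le_trans (enorm_dist_triangle _ (x N) _) _.
by rewrite lerD2l IH.
Qed.

Lemma step_vanishes (eta : R) : r @ \oo --> 0 -> 0 < eta ->
  \forall k \near \oo, d k <= eta.
Proof.
move=> r_to0 eta0; have b0 : 0 < a * eta ^+ 2 by rewrite mulr_gt0// exprn_gt0.
apply: filterS (cvgr_le _ r_to0 _ b0) => k rk.
rewrite -(@ler_pXn2r _ 2)// ?nnegrE ?(ltW eta0)// -(ler_pM2l a0).
by apply: le_trans (descent k) _; apply: le_trans rk; rewrite gerBl.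
Qed.

Lemma powR_vanishes (s eta : R) : 0 < s -> r @ \oo --> 0 -> 0 < eta ->
  \forall k \near \oo, r k `^ s <= eta.
Proof.
move=> s0 r_to0 eta0; have b0 : 0 < eta `^ s^-1 by rewrite powR_gt0.
apply: filterS (cvgr_le _ r_to0 _ b0) => k rk.
have -> : eta = (eta `^ s^-1) `^ s.
  by rewrite -powRrM mulVf ?gt_eqF// powRr1// ltW.
by rewrite ge0_ler_powR ?nnegrE ?r0 ?powR_ge0 ?(ltW s0).
Qed.

(** Trapping: near a cluster point the remaining length is too short to leave
    the ball in which the inequality of the previous lemmas is known. *)
Lemma trapping (xb : 'rV[R]_n) (rho : R) (K : nat) : 0 < rho ->
  (forall k, (K <= k)%N -> enorm (x k - xb) <= rho ->
     enorm (x k.+1 - xb) <= rho -> r k.+1 `^ t <= C * (d k + e k)) ->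
  r @ \oo --> 0 -> bounded_sums e ->
  (forall (eta : R) N, 0 < eta ->
     exists2 k, (N <= k)%N & enorm (x k - xb) <= eta) ->
  forall eta : R, 0 < eta -> \forall k \near \oo, enorm (x k - xb) <= eta.
Proof.
move=> rho0 local r_to0 eS clus eta' eta'0.
pose eta := Num.min rho eta'.
have eta0 : 0 < eta by rewrite lt_min rho0.
have eta_rho : eta <= rho by rewrite ge_min lexx.
have eta_eta' : eta <= eta' by rewrite ge_min lexx orbT.
have e8 : 0 < eta / 8 by rewrite divr_gt0.
have eM8 : 0 < eta / 8 / M by rewrite divr_gt0.
have s0 : 0 < 1 - t by rewrite subr_gt0; case/andP: t01.
have [N _ HN] : \forall k \near \oo, (K <= k)%N /\ d k <= eta / 8 /\
    (forall N, \sum_(k <= j < N) e j <= eta / 8) /\ r k `^ (1 - t) <= eta / 8 / M.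
  near=> k; do !split.
  - by near: k; exists K.
  - by near: k; apply: step_vanishes.
  - by near: k; apply: bounded_sums_tail.
  - by near: k; apply: powR_vanishes.
(* The start contributes eta / 4; the first step, the errors and the power of
   the merit function contribute at most eta / 8 each, the first step twice. *)
have [m Nm xm] := clus (eta / 4) N (divr_gt0 eta0 (ltr0n _ 4)).
suff trapped N' : (m <= N')%N ->
    forall k, (m <= k <= N')%N -> enorm (x k - xb) <= eta.
  exists m => // k /= mk; apply: le_trans (trapped k mk k _) eta_eta'.
  by rewrite mk leqnn.
have [Km [dm [em _]]] := HN m Nm; have [_ [_ [_ rm]]] := HN m.+1 (leqW Nm).
elim: N' => [|N' IH].
  rewrite leqn0 => /eqP m0 k /andP[_]; rewrite leqn0 => /eqP k0.
  have -> : k = m by rewrite k0 m0.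
  lra.
rewrite leq_eqVlt => /orP[/eqP <- k|mN].
  by rewrite -eqn_leq => /eqP <-; lra.
move=> k /andP[mk]; rewrite leq_eqVlt => /orP[/eqP ->|kN]; last first.
  by apply: IH => //; rewrite mk.
have len : \sum_(m.+1 <= k < N'.+1) d k <=
    d m + \sum_(m <= k < N') e k + M * r m.+1 `^ (1 - t).
  apply: length_le_simple => // j /andP[mj jN]; apply: local.
  - exact: leq_trans mj.
  - by apply: le_trans eta_rho; apply: IH => //; rewrite mj ltnW.
  - by apply: le_trans eta_rho; apply: IH => //; rewrite leqW.
have h1 := enorm_dist_triangle (x N'.+1) (x m) xb.
have h2 := enorm_le_length (leqW mN : (m <= N'.+1)%N).
rewrite big_ltn// in h2; have h3 := em N'.
have h4 : M * r m.+1 `^ (1 - t) <= eta / 8.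
  by rewrite mulrC -ler_pdivlMr.
lra.
Unshelve. all: by end_near.
Qed.

(** [T k] is the length of the trajectory from [x k] on. *)
Lemma remaining_length (Q : nat -> R) (K : nat) :
  (forall k, (K <= k)%N -> r k.+1 `^ t <= C * (d k + e k)) ->
  (forall m N, (K <= m)%N -> \sum_(m <= k < N) e k <= Q m) ->
  exists T : nat -> R, [/\ forall k, 0 <= T k, forall k, T k - T k.+1 = d k &
    forall m, (K <= m)%N -> T m.+1 <= d m + Q m + M * r m.+1 `^ (1 - t)].
Proof.
move=> kl eQ.
have len m N : (K <= m)%N -> \sum_(m.+1 <= k < N) d k <=
    d m + Q m + M * r m.+1 `^ (1 - t).
  move=> Km; have Q0 : 0 <= Q m.
    by apply: le_trans (eQ m 0%N Km); rewrite sum_nat_ge0.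
  have [Nm|mN] := leqP N m.+1.
    by rewrite big_geq// !addr_ge0// mulr_ge0 ?powR_ge0// ltW.
  case: N mN => // N mN; apply: le_trans (@length_le_simple m N (ltnW mN) _) _.
    by move=> k /andP[mk _]; apply: kl; exact: leq_trans mk.
  by rewrite lerD2r lerD2l eQ.
have dS : bounded_sums d.
  pose b := d K + Q K + M * r K.+1 `^ (1 - t).
  exists (\sum_(0 <= k < K.+1) d k + b) => N.
  have [NK|/ltnW KN] := leqP N K.+1.
    apply: le_trans (sum_nat_mono 0 d0 NK) _; rewrite lerDl.
    by apply: le_trans (len K 0%N (leqnn K)); rewrite big_geq.
  by rewrite (big_cat_nat (leq0n _) KN)/= lerD2l len.
have [T [T0 Td Tmin]] := remainder_exists d0 dS.
by exists T; split=> // m Km; apply: Tmin => N; exact: len.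
Qed.

Lemma enorm_le_remaining_length (T : nat -> R) (xb : 'rV[R]_n) :
  (forall k, 0 <= T k) -> (forall k, T k - T k.+1 = d k) ->
  (forall eta : R, 0 < eta -> \forall k \near \oo, enorm (x k - xb) <= eta) ->
  forall k, enorm (x k - xb) <= T k.
Proof.
move=> T0 Td x_to k; apply/ler_addgt0Pr => eta eta0.
have [N _ HN] := x_to _ eta0.
have := HN (maxn N k) (leq_maxl _ _).
have kN : (k <= maxn N k)%N := leq_maxr _ _.
have := enorm_le_length kN; rewrite (remainder_sum kN Td).
have := enorm_dist_triangle (x k) (x (maxn N k)) xb.
rewrite [enorm (x k - x _)]enorm_distC; have := T0 (maxn N k); lra.
Qed.

End Length.

(** * Convergence rates *)

(** The assumption [KL] holds for every exponent above [theta], with its own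
    constant; the rates follow from the choice of the exponent. *)

Section Rates.
Context {R : realType} {n : nat}.
Context (a theta : R) (x : nat -> 'rV[R]_n) (xb : 'rV[R]_n) (r eps E : nat -> R).
Let d k := enorm (x k.+1 - x k).
Hypotheses (a0 : 0 < a) (r0 : forall k, 0 <= r k) (r_to0 : r @ \oo --> 0).
Hypothesis descent : forall k, a * d k ^+ 2 <= r k - r k.+1.
Hypothesis x_to : forall eta : R, 0 < eta ->
  \forall k \near \oo, enorm (x k - xb) <= eta.
Hypothesis E0 : forall k, 0 <= E k.
Hypotheses (E_rec : forall k, E k - E k.+1 = eps k) (E_to0 : E @ \oo --> 0).
Hypothesis KL : forall t : R, theta <= t -> 0 < t < 1 ->
  exists2 C : R, 0 < C & \forall k \near \oo,
    r k.+1 `^ t <= C * (d k + (Num.sqrt (eps k) + E k.+1 `^ t)).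

Let e (t : R) k := Num.sqrt (eps k) + E k.+1 `^ t.

Let e0 (t : R) k : 0 <= e t k.
Proof. by rewrite addr_ge0 ?sqrtr_ge0 ?powR_ge0. Qed.

Let d0 k : 0 <= d k. Proof. exact: enorm_ge0. Qed.

Lemma remainder_le_telescope (b : nat -> R) m :
  (forall k, 0 <= b k) -> (forall k, (m <= k)%N -> eps k <= b k - b k.+1) ->
  E m <= b m.
Proof.
move=> b0 eb; apply/ler_addgt0Pr => eta eta0.
have [N _ HN] := cvgr_le _ E_to0 _ eta0.
have := HN (maxn N m) (leq_maxl _ _).
have := sum_le_telescope (maxn N m) b0 eb.
rewrite (remainder_sum (leq_maxr N m) E_rec) /=; lra.
Qed.

Lemma sum_power_le (u : nat -> R) (al B : R) m N : 0 < al -> 0 <= B ->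
  (0 < m)%N -> (forall k, (m <= k)%N -> u k <= B * k.+1%:R `^ (- (1 + al))) ->
  \sum_(m <= k < N) u k <= B / al * m%:R `^ (- al).
Proof.
move=> al0 B0 m0 ub.
apply: (@sum_le_telescope _ u (fun k => B / al * k%:R `^ (- al))) => k.
  by rewrite mulr_ge0 ?powR_ge0// divr_ge0// ltW.
move=> mk; apply: le_trans (ub k mk) _; rewrite -mulrBr.
have k0 : 0 < k%:R :> R by rewrite ltr0n (leq_trans m0).
have := powR_diff_ge k0 al0; rewrite natr1 => h.
rewrite -mulrA ler_wpM2l// mulrC ler_pdivlMr// mulrC; exact: h.
Qed.

(** The exponent [(1 + al) / (1 + 2 * al)] is the one for which the rate is
    [k ^ (- al)]. *)
Lemma sublinear_rate (al B : R) : 0 < al -> 0 < B ->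
  theta <= (1 + al) / (1 + 2 * al) ->
  (\forall k \near \oo, e ((1 + al) / (1 + 2 * al)) k <=
     B * k.+1%:R `^ (- (1 + al))) ->
  eventually_bigO (fun k => enorm (x k - xb)) (fun k => k%:R `^ (- al)).
Proof.
move=> al0 B0; set t := (1 + al) / _ => theta_t e_le.
have al2 : 0 < 1 + 2 * al by lra.
have t01 : 0 < t < 1.
  by apply/andP; split; [rewrite divr_gt0//|rewrite ltr_pdivrMr//]; lra.
have [C C0 kl] := KL theta_t t01.
have d_small := step_vanishes a0 r0 descent r_to0 ltr01.
have [K _ HK] : \forall k \near \oo, (0 < k)%N /\ d k <= 1 /\
    e t k <= B * k.+1%:R `^ (- (1 + al)) /\ r k.+1 `^ t <= C * (d k + e t k).
  near=> k; do !split.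
  - by near: k; exists 1%N.
  - by near: k.
  - by near: k.
  - by near: k.
pose Q m := B / al * 2 `^ al * m.+1%:R `^ (- al).
have Bal : 0 < B / al by rewrite divr_gt0.
have eQ m N : (K <= m)%N -> \sum_(m <= k < N) e t k <= Q m.
  move=> Km; have [m0 _] := HK m Km.
  apply: le_trans (sum_power_le N al0 (ltW B0) m0 _) _.
    by move=> k mk; have [_ [_ []]] := HK k (leq_trans Km mk).
  rewrite /Q -[leRHS]mulrA ler_pM2l//; apply: powRN_half => //; first exact: ltW.
  have m1 : 1 <= m%:R :> R by rewrite ler1n.
  by rewrite -natr1; lra.
have klK k : (K <= k)%N -> r k.+1 `^ t <= C * (d k + e t k).
  by move=> /HK[_ [_ []]].
have [T [T0 Td Tle]] := remaining_length t01 a0 C0 (e0 t) r0 descent klK eQ.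
set M := C / _ in Tle.
have M0 : 0 < M.
  by rewrite divr_gt0// mulr_gt0// subr_gt0; case/andP: t01.
clearbody M; pose p := (1 + al) / al; have p0 : 0 < p by rewrite divr_gt0//; lra.
have p1 : 1 <= p by rewrite /p ler_pdivlMr//; lra.
pose B1 := B / al * 2 `^ al; have B10 : 0 < B1 by rewrite mulr_gt0// powR_gt0.
pose C' := 3 `^ p * (1 + B1 `^ p + M `^ p * C * (1 + B)).
have MC0 : 0 < M `^ p * C by rewrite mulr_gt0// powR_gt0.
have C'0 : 0 < C'.
  rewrite mulr_gt0 ?powR_gt0//; have := powR_ge0 B1 p.
  by have := mulr_gt0 MC0 B0; lra.
have rec k : (K <= k)%N ->
    T k.+1 `^ p <= C' * (T k - T k.+1) + C' * k.+1%:R `^ (- (1 + al)).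
  move=> Kk; have [k0 [d1 [ek rk]]] := HK k Kk.
  rewrite (Td k : _ = d k); set Y := k.+1%:R `^ _ in ek *.
  have Y0 : 0 <= Y by exact: powR_ge0.
  have Qk : 0 <= Q k by rewrite mulr_ge0 ?powR_ge0// ltW.
  have Mr : 0 <= M * r k.+1 `^ (1 - t) by rewrite mulr_ge0 ?powR_ge0// ltW.
  apply: (@le_trans _ _ ((d k + Q k + M * r k.+1 `^ (1 - t)) `^ p)).
    by rewrite ge0_ler_powR ?nnegrE ?T0 ?addr_ge0 ?Tle// ltW.
  apply: le_trans (powR_add3_le (ltW p0) (d0 k) Qk Mr) _.
  rewrite /C' -!mulrA -mulrDr ler_pM2l ?powR_gt0//.
  have dp : d k `^ p <= d k.
    have [->|dk] := eqVneq (d k) 0; first by rewrite powR0 ?gt_eqF.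
    by rewrite ge1r_powR// d1 lt_neqAle eq_sym dk d0.
  have Qp : Q k `^ p = B1 `^ p * Y.
    rewrite powRM ?(ltW B10) ?powR_ge0// -powRrM; congr (_ * _ `^ _).
    by rewrite /p; field; rewrite gt_eqF.
  have Mp : (M * r k.+1 `^ (1 - t)) `^ p = M `^ p * r k.+1 `^ t.
    rewrite powRM ?(ltW M0) ?powR_ge0// -powRrM; congr (_ * _ `^ _).
    by rewrite /p /t; field; rewrite !gt_eqF.
  rewrite Qp Mp.
  have h1 : M `^ p * r k.+1 `^ t <= M `^ p * C * (d k + B * Y).
    rewrite -mulrA ler_wpM2l ?powR_ge0//; apply: le_trans rk _.
    by rewrite ler_pM2l// lerD2l.
  have h2 : 0 <= M `^ p * C * B * d k by rewrite !mulr_ge0 ?powR_ge0// ltW.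
  have h3 : 0 <= M `^ p * C * Y by rewrite !mulr_ge0 ?powR_ge0// ltW.
  have h4 : 0 <= B1 `^ p * d k by rewrite mulr_ge0 ?powR_ge0.
  clear Qp Mp Qk Mr rk ek d1 MC0 C'0 B10 p1 p0 M0 Bal al2 theta_t t01; lra.
have [A A0 TA] := power_rate_of_recursion al0 C'0 T0 rec.
exists A => //; exists K.+1 => // k /= Kk.
exact: le_trans (enorm_le_remaining_length T0 Td x_to k) (TA k Kk).
Unshelve. all: by end_near.
Qed.

Lemma linear_rate (w B : R) : 0 < w < 1 -> 0 < B -> theta <= 1 / 2 ->
  (\forall k \near \oo, e (1 / 2) k <= B * w ^+ k) ->
  exists2 rho : R, 0 < rho < 1 &
    eventually_bigO (fun k => enorm (x k - xb)) (fun k => rho ^+ k).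
Proof.
move=> w01 B0; have := w01 => /andP[w0 w1]; set t := 1 / 2 => theta_t e_le.
have t01 : 0 < t < 1 by rewrite /t; lra.
have [C C0 kl] := KL theta_t t01.
have [K _ HK] : \forall k \near \oo,
    e t k <= B * w ^+ k /\ r k.+1 `^ t <= C * (d k + e t k).
  by near=> k; split; near: k.
have w1' : 0 < 1 - w by rewrite subr_gt0.
pose Q m := B / (1 - w) * w ^+ m.
have eQ m N : (K <= m)%N -> \sum_(m <= k < N) e t k <= Q m.
  move=> Km; apply: sum_le_telescope => k.
    by rewrite mulr_ge0 ?exprn_ge0 ?(ltW w0)// divr_ge0// ltW.
  move=> mk; have [ek _] := HK k (leq_trans Km mk).
  apply: le_trans ek _; rewrite /Q exprS -mulrBr.
  have -> : B / (1 - w) * (w ^+ k - w * w ^+ k) = B * w ^+ k.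
    by field; rewrite gt_eqF.
  exact: lexx.
have klK k : (K <= k)%N -> r k.+1 `^ t <= C * (d k + e t k) by move=> /HK[].
have [T [T0 Td Tle]] := remaining_length t01 a0 C0 (e0 t) r0 descent klK eQ.
set M := C / _ in Tle.
have M0 : 0 < M.
  by rewrite divr_gt0// mulr_gt0// subr_gt0; case/andP: t01.
clearbody M; pose C' := 1 + B / (1 - w) + M * C * (1 + B).
have Bw : 0 < B / (1 - w) by rewrite divr_gt0.
have MC0 : 0 < M * C by rewrite mulr_gt0.
have MCB := mulr_gt0 MC0 B0.
have C'0 : 0 < C' by rewrite /C'; lra.
have rec k : (K <= k)%N -> T k.+1 <= C' * (T k - T k.+1) + C' * w ^+ k.
  move=> Kk; have [ek rk] := HK k Kk; rewrite (Td k : _ = d k).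
  have wk : 0 < w ^+ k by rewrite exprn_gt0.
  have dk := d0 k.
  apply: le_trans (Tle k Kk) _.
  have -> : 1 - t = t by rewrite /t; field.
  have h1 : M * r k.+1 `^ t <= M * C * (d k + B * w ^+ k).
    by rewrite -mulrA ler_pM2l//; apply: le_trans rk _; rewrite ler_pM2l// lerD2l.
  have h2 := mulr_ge0 (ltW MCB) dk; have h3 := mulr_ge0 (ltW MC0) (ltW wk).
  have h4 := mulr_ge0 (ltW Bw) dk.
  rewrite /C' /Q -/(d k); lra.
have [rho rho01 [A A0 TA]] := linear_rate_of_recursion w01 C'0 T0 rec.
exists rho => //; exists A => //; exists K => // k /= Kk.
exact: le_trans (enorm_le_remaining_length T0 Td x_to k) (TA k Kk).
Unshelve. all: by end_near.
Qed.

Section Polynomial.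
Context (eps0 q : R).
Hypotheses (eps00 : 0 < eps0) (q2 : 2 < q).
Hypothesis polynomial : forall k, eps k = eps0 / (k.+1%:R `^ q).

(** The tail of the series [k.+1 `^ (- q)] loses one order. *)
Lemma remainder_polynomial m : (0 < m)%N ->
  E m <= eps0 / (q - 1) * m%:R `^ (- (q - 1)).
Proof.
move=> m0; have q1 : 0 < q - 1 by move: q2; lra.
apply: (@remainder_le_telescope (fun k => eps0 / (q - 1) * k%:R `^ (- (q - 1)))).
  by move=> k; rewrite mulr_ge0 ?powR_ge0// divr_ge0// ltW.
move=> k mk; rewrite polynomial -mulrBr -powRN.
have k0 : 0 < k%:R :> R by rewrite ltr0n (leq_trans m0).
have := powR_diff_ge k0 q1.
rewrite natr1 (_ : 1 + (q - 1) = q) => [h|]; last by ring.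
by rewrite -mulrA ler_pM2l// mulrC ler_pdivlMr// mulrC.
Qed.

Lemma polynomial_rate (al : R) : 0 < al -> al <= q / 2 - 1 ->
  theta <= (1 + al) / (1 + 2 * al) ->
  eventually_bigO (fun k => enorm (x k - xb)) (fun k => k%:R `^ (- al)).
Proof.
move=> al0 al_le; set t := (1 + al) / _ => theta_t.
have al2 : 0 < 1 + 2 * al by lra.
have t0 : 0 < t by rewrite divr_gt0//; lra.
have q1 : 0 < q - 1 by move: q2; lra.
pose c := eps0 / (q - 1); have c0 : 0 < c by rewrite divr_gt0.
apply: (@sublinear_rate al (Num.sqrt eps0 + c `^ t)) => //.
  by rewrite addr_gt0 ?sqrtr_gt0 ?powR_gt0.
near=> k; rewrite -/t /e mulrDl.
have k1 : 1 <= k.+1%:R :> R by rewrite ler1n.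
have mono u v : u <= v -> k.+1%:R `^ (- v) <= k.+1%:R `^ (- u) :> R.
  by move=> uv; rewrite ler_powR// lerN2.
apply: lerD.
  rewrite polynomial sqrtrM ?(ltW eps00)// ler_pM2l ?sqrtr_gt0//.
  rewrite -powRN -powR12_sqrt ?powR_ge0// -powRrM mulNr.
  by apply: mono; move: al_le; lra.
apply: (@le_trans _ _ ((c * k.+1%:R `^ (- (q - 1))) `^ t)).
  rewrite ge0_ler_powR ?nnegrE ?E0 ?(ltW t0)
    ?(mulr_ge0 (ltW c0) (powR_ge0 _ _))//.
  exact: remainder_polynomial.
rewrite powRM ?(ltW c0) ?powR_ge0// ler_pM2l ?powR_gt0// -powRrM mulNr.
apply: mono; rewrite /t mulrA ler_pdivlMr// mulrC; move: al_le q2 al0; nra.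
Unshelve. all: by end_near.
Qed.

End Polynomial.

Section Geometric.
Context (eps0 zeta : R).
Hypotheses (eps00 : 0 < eps0) (zeta01 : 0 < zeta < 1).
Hypothesis geometric : forall k, eps k = eps0 * zeta ^+ k.

Let w := Num.sqrt zeta.

Let w01 : 0 < w < 1.
Proof.
have /andP[z0 z1] := zeta01.
by rewrite sqrtr_gt0 z0 -sqrtr1 ltr_sqrt.
Qed.

(** The square root of [eps] is geometric of ratio [Num.sqrt zeta]; for [1 / 2 <= t]
    the power [t] of the tail decreases at least as fast. *)
Lemma error_geometric (t : R) : 1 / 2 <= t -> t <= 1 ->
  exists2 B : R, 0 < B & forall k, e t k <= B * w ^+ k.
Proof.
move=> t_half t1; have /andP[z0 z1] := zeta01; have z1' : 0 < 1 - zeta by lra.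
pose c := eps0 / (1 - zeta); have c0 : 0 < c by rewrite divr_gt0.
have t0 : 0 < t by lra.
have Ek m : E m <= c * zeta ^+ m.
  apply: (@remainder_le_telescope (fun k => c * zeta ^+ k)) => k.
    by rewrite mulr_ge0 ?exprn_ge0// ltW.
  move=> _; rewrite geometric exprS -mulrBr.
  have -> : c * (zeta ^+ k - zeta * zeta ^+ k) = eps0 * zeta ^+ k.
    by rewrite /c; field; rewrite gt_eqF.
  exact: lexx.
exists (Num.sqrt eps0 + c `^ t) => [|k].
  by rewrite addr_gt0 ?sqrtr_gt0 ?powR_gt0.
rewrite /e mulrDl; apply: lerD.
  rewrite geometric sqrtrM ?(ltW eps00)// ler_pM2l ?sqrtr_gt0//.
  have -> : zeta ^+ k = (w ^+ k) ^+ 2 by rewrite exprAC sqr_sqrtr ?(ltW z0).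
  by rewrite sqrtr_sqr ger0_norm ?exprn_ge0 ?sqrtr_ge0.
apply: (@le_trans _ _ ((c * zeta ^+ k) `^ t)).
  rewrite ge0_ler_powR ?nnegrE ?E0 ?(ltW t0)
    ?(mulr_ge0 (ltW c0) (exprn_ge0 _ (ltW z0)))//.
  apply: le_trans (Ek _) _; rewrite ler_pM2l// exprS ler_piMl ?ltW ?exprn_gt0//.
rewrite powRM ?(ltW c0) ?exprn_ge0 ?(ltW z0)// ler_pM2l ?powR_gt0//.
rewrite -powR_mulrn ?(ltW z0)// powRAC powR_mulrn ?powR_ge0//.
rewrite lerXn2r// ?nnegrE ?powR_ge0 ?sqrtr_ge0// /w -powR12_sqrt ?(ltW z0)//.
by apply: ger_powR; [rewrite z0 ltW|lra].
Qed.

Lemma geometric_linear_rate : theta <= 1 / 2 ->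
  exists2 rho : R, 0 < rho < 1 &
    eventually_bigO (fun k => enorm (x k - xb)) (fun k => rho ^+ k).
Proof.
move=> theta_half; have [||B B0 eB] := @error_geometric (1 / 2); [lra|lra|].
by apply: (linear_rate w01 B0 theta_half); exists 0%N => // k _; exact: eB.
Qed.

Lemma geometric_sublinear_rate (al : R) : 0 < al ->
  theta <= (1 + al) / (1 + 2 * al) ->
  eventually_bigO (fun k => enorm (x k - xb)) (fun k => k%:R `^ (- al)).
Proof.
move=> al0 theta_t; have al2 : 0 < 1 + 2 * al by lra.
have [||B B0 eB] := @error_geometric ((1 + al) / (1 + 2 * al)).
- by rewrite ler_pdivlMr//; lra.
- by rewrite ler_pdivrMr//; lra.
have [B' B'0 wB] := geometric_le_power w01 (addr_gt0 ltr01 al0).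
apply: (sublinear_rate al0 (mulr_gt0 B0 B'0) theta_t).
exists 0%N => // k _; apply: le_trans (eB k) _.
by rewrite -mulrA ler_pM2l.
Qed.

End Geometric.

End Rates.

(** * The subdifferential of the quotient *)

Section Quotient.
Context {R : realType} {n : nat}.
Context (f : 'rV[R]_n -> \bar R) (h g : 'rV[R]_n -> R).
Implicit Types (x z xi : 'rV[R]_n).

Lemma edom_fine x : eproper f -> edom f x -> f x = (fine (f x))%:E.
Proof.
move=> [fNy _]; have := fNy x; rewrite /edom /=.
by case: (f x) => //.
Qed.

Lemma objective_fin x : edom f x -> g x != 0 ->
  objective f h g x = (fracval f h g x)%:E.
Proof. by rewrite /objective /edom /= => -> ->. Qed.

Lemma eps_subdiff_fine delta x xi z : eproper f -> edom f x -> edom f z ->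
  eps_subdiff f delta x xi ->
  fine (f x) + dot xi (z - x) - delta <= fine (f z).
Proof.
move=> fp fx fz /(_ z); rewrite -lee_fin EFinB EFinD.
by rewrite -(edom_fine fp fx) -(edom_fine fp fz).
Qed.

(** First-order lower bound of the quotient along the domain of [f], with slope
    given by the quotient rule. *)
Lemma quotient_linear_approx x xi (eta : R) :
  eproper f -> edom f x -> 0 < g x -> 0 <= fracval f h g x ->
  differentiable (h : 'rV[R]_n -> R^o) x ->
  differentiable (g : 'rV[R]_n -> R^o) x ->
  eps_subdiff f 0 x xi -> 0 < eta ->
  let w := (g x)^-1 *: (xi + gradient h x - fracval f h g x *: gradient g x) in
  \forall z \near x, edom f z -> [/\ g z != 0 &
    - eta * enorm (z - x) <= fracval f h g z - fracval f h g x - dot w (z - x)].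
Proof.
move=> fp fx gx c0 dh dg xif eta0 w.
set c := fracval f h g x in c0 w *.
have cg : fine (f x) + h x = c * g x.
  by rewrite /c /fracval divfK// gt_eqF.
have w0 := enorm_ge0 w.
(* This precision makes the three error terms, from [h], from [c * g] and from
   the variation of [g] in the denominator, add up to at most [eta * g z] since
   [g x / 2 <= g z]. *)
pose e := eta * g x / (2 * (enorm w + 1 + c)).
have s0 : 0 < 2 * (enorm w + 1 + c) by rewrite mulr_gt0//; lra.
have e0 : 0 < e by rewrite divr_gt0// mulr_gt0.
have gx2 : 0 < g x / 2 by rewrite divr_gt0.
have cg' : g @ x --> g x := differentiable_continuous dg.
have near_e := (cvgrPdist_le _ _).1 cg' _ e0.
have near_g := (cvgrPdist_le _ _).1 cg' _ gx2.
have near_eg : \forall z \near x, `|g x - g z| <= e /\ `|g x - g z| <= g x / 2.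
  near=> z; split; near: z; [exact: near_e|exact: near_g].
move: (gradient_approx dh e0) (gradient_approx dg e0) near_eg.
apply: filterS3 => z hz gz [ez g2] fz.
have gz2 : g x / 2 <= g z by have := ler_norm (g x - g z); lra.
have gz0 : 0 < g z by apply: lt_le_trans gz2.
split; first by rewrite gt_eqF.
have fz' := eps_subdiff_fine fp fx fz xif.
set D := enorm (z - x) in hz gz *; have D0 : 0 <= D := enorm_ge0 _.
set S := dot w (z - x).
have SD : `|S| <= enorm w * D := dot_le_enorm _ _.
have gS : g x * S = dot xi (z - x) + dot (gradient h x) (z - x)
    - c * dot (gradient g x) (z - x).
  by rewrite /S /w dotZl mulrA divff ?gt_eqF// mul1r !dotDl dotNl dotZl.
have -> : fracval f h g z = (fine (f z) + h z) / g z by [].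
rewrite -subr_ge0.
have -> : (fine (f z) + h z) / g z - c - S - - eta * D =
    (fine (f z) + h z - c * g z - g z * S + eta * g z * D) / g z.
  by field; rewrite gt_eqF.
rewrite divr_ge0 ?(ltW gz0)//.
have hz' := ler_normlW (_ : `|- (h z - h x - dot (gradient h x) (z - x))| <= _).
have {}hz' : dot (gradient h x) (z - x) - e * D <= h z - h x.
  by have := hz' _; rewrite normrN => /(_ _ hz); lra.
have gz' : c * (g z - g x - dot (gradient g x) (z - x)) <= c * (e * D).
  by rewrite ler_wpM2l// (ler_normlW gz).
have gS' : (g z - g x) * S <= e * (enorm w * D).
  apply: le_trans (ler_norm _) _; rewrite normrM.
  by rewrite ler_pM// distrC.
have eE : e * (2 * (enorm w + 1 + c)) = eta * g x.
  by rewrite /e divfK// gt_eqF.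
have eE' : e * (enorm w + 1 + c) * D <= eta * g z * D.
  rewrite ler_wpM2r//; have : eta * (g x / 2) <= eta * g z by rewrite ler_pM2l.
  by move: eE; lra.
move: fz' hz' gz' gS' eE' gS cg; rewrite -/S; lra.
Unshelve. all: by end_near.
Qed.

Lemma frechet_objective x xi :
  eproper f -> edom f x -> 0 < g x -> 0 <= fracval f h g x ->
  differentiable (h : 'rV[R]_n -> R^o) x ->
  differentiable (g : 'rV[R]_n -> R^o) x ->
  eps_subdiff f 0 x xi ->
  frechet_subdiff (objective f h g) x
    ((g x)^-1 *: (xi + gradient h x - fracval f h g x *: gradient g x)).
Proof.
move=> fp fx gx c0 dh dg xif; set w := _ *: _.
have Fx : objective f h g x = (fracval f h g x)%:E.
  by rewrite objective_fin// gt_eqF.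
split; first by rewrite /edom /= Fx ltry.
rewrite Fx limf_einfE; apply/lee_subgt0Pr => eta eta0.
apply: le_trans (ereal_sup_ubound _); last first.
  exists [set z | z != x /\ (edom f z -> g z != 0 /\ - eta * enorm (z - x) <=
    fracval f h g z - fracval f h g x - dot w (z - x))]; last by reflexivity.
  rewrite /dnbhs /within /=.
  have := quotient_linear_approx fp fx gx c0 dh dg xif eta0.
  by apply: filterS => z hz zx; split=> // fz; have [] := hz fz.
apply: le_ereal_inf_tmp => _ [z [zx hz] <-].
have D0 : 0 < enorm (z - x).
  rewrite lt_neqAle enorm_ge0 andbT eq_sym; apply: contra_neq zx.
  by move=> /enorm_eq0/eqP; rewrite subr_eq0 => /eqP.
have [fz|fz] := pselect (edom f z); last first.
  have -> : objective f h g z = +oo%E.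
    by rewrite /objective; have -> : (f z < +oo)%E = false by apply/negP.
  by rewrite /= gt0_mulye ?leey// lte_fin invr_gt0.
have [gz ge] := hz fz.
rewrite objective_fin// sub0e -!EFinB -EFinM -EFinN lee_fin ler_pdivlMr//.
Qed.

End Quotient.

(** * Convergence and compactness in Euclidean space *)

Section EuclideanTopology.
Context {R : realType} {n : nat}.
Implicit Types (p z : 'rV[R]_n).

Lemma near_enorm p (eta : R) : 0 < eta -> \forall z \near p, enorm (z - p) <= eta.
Proof.
move=> eta0; have n0 : 0 < n%:R + 1 :> R by rewrite ltr_wpDl.
have e0 : 0 < eta / (n%:R + 1) by rewrite divr_gt0.
have : \forall z \near p, `|p - z| <= eta / (n%:R + 1).
  by have /cvgrPdist_le /(_ _ e0) := @cvg_id _ (nbhs p).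
apply: filterS => z; rewrite distrC ler_pdivlMr// => hz.
apply: le_trans (enorm_le_norm _) _; apply: le_trans hz.
by rewrite mulrC ler_wpM2l// lerDl.
Qed.

Lemma nbhs_enorm p (A : set 'rV[R]_n) : nbhs p A ->
  exists2 rho : R, 0 < rho & forall z, enorm (z - p) <= rho -> A z.
Proof.
move=> /nbhs_normP[r /= r0 rA]; exists (r / 2); first by rewrite divr_gt0.
move=> z hz; apply: rA => /=; rewrite distrC.
apply: le_lt_trans (norm_le_enorm _) _; apply: le_lt_trans hz _.
by rewrite ltr_pdivrMr//; lra.
Qed.

Lemma cvg_enorm (u : nat -> 'rV[R]_n) p :
  (forall eta : R, 0 < eta -> \forall k \near \oo, enorm (u k - p) <= eta) ->
  u @ \oo --> p.
Proof.
move=> h; apply/cvgrPdist_le => e e0; apply: filterS (h e e0) => k hk.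
by rewrite distrC; apply: le_trans (norm_le_enorm _) hk.
Qed.

Lemma compact_norm_le (B : R) : compact [set z : 'rV[R]_n | `|z| <= B].
Proof.
apply: bounded_closed_compact.
  exists B; split; first exact: num_real.
  by move=> M BM z /= /le_trans; apply; exact: ltW.
have -> : [set z : 'rV[R]_n | `|z| <= B] = closed_ball_ Num.norm 0 B.
  by apply/seteqP; split => z; rewrite /closed_ball_ /= sub0r normrN.
exact: closed_closed_ball_.
Qed.

Lemma bounded_seq_cluster (u : nat -> 'rV[R]_n) (B : R) :
  (forall k, `|u k| <= B) ->
  exists p, forall (eta : R) N, 0 < eta ->
    exists2 k, (N <= k)%N & enorm (u k - p) <= eta.
Proof.
move=> uB; pose K : set 'rV[R]_n := [set z | `|z| <= B].
have K_compact : compact K by exact: compact_norm_le.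
have uK : (u @ \oo) K by exists 0%N => // k _; exact: uB.
have [p [_ clp]] := K_compact (u @ \oo) _ uK.
exists p => eta N eta0.
have uN : (u @ \oo) [set z | exists2 k, (N <= k)%N & z = u k].
  by exists N => // k /= Nk; exists k.
have [z [[k Nk ->] hk]] := clp _ _ uN (near_enorm p eta0).
by exists k.
Qed.

Lemma bounded_on_bounded (phi : 'rV[R]_n -> R) (B : R) : continuous phi ->
  exists2 M : R, 0 < M & forall z, `|z| <= B -> phi z <= M.
Proof.
move=> cphi; pose K : set 'rV[R]_n := [set z | `|z| <= B].
have K_compact : compact K by exact: compact_norm_le.
have [B0|B0] := leP 0 B; last first.
  exists 1 => // z zB; have : 0 <= `|z| by [].
  by rewrite leNgt (le_lt_trans zB B0).
have K0 : K !=set0 by exists 0; rewrite /K /= normr0.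
have [|z Kz zmax] := EVT_max_rV K0 K_compact (f := phi).
  exact: continuous_subspaceT.
exists (`|phi z| + 1) => [|v vB]; first by rewrite ltr_wpDl.
by apply: le_trans (zmax v _) _ => //; rewrite ?inE// ler_wpDr// ler_norm.
Qed.

End EuclideanTopology.

(** * The iterates *)

Section Iterates.
Context {R : realType} {n : nat}.
Context (f : 'rV[R]_n -> \bar R) (h g : 'rV[R]_n -> R) (Lh : R).
Context (eps : nat -> R) (H : nat -> 'M[R]_n) (x y Delta : nat -> 'rV[R]_n).
Context (delta : nat -> R) (gamma_lo gamma_hi : R).
Hypothesis hA : standing_assumptions f h g Lh.
Hypothesis f_lip : f_locally_lipschitz f.
Hypothesis g_C1 : continuously_differentiable_on (Omega g) g.
Hypothesis g_lip : g_gradient_locally_lipschitz g.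
Hypothesis alg : iVPGSA f h g eps H x y Delta delta.
Hypothesis gamma_lo_gt : Lh / 2 < gamma_lo.
Hypothesis gamma_hi_gt0 : 0 < gamma_hi.
Hypothesis H_bounds : forall k,
  loewner_le gamma_lo%:M (H k) /\ loewner_le (H k) gamma_hi%:M.

Let d k := enorm (x k.+1 - x k).
Let c k := fracval f h g (x k).

Let fp : eproper f. Proof. by case: hA. Qed.

Let fx k : edom f (x k). Proof. by have [] := iterates_feasible alg k. Qed.

Let eps0 k : 0 <= eps k. Proof. exact: eps_nonneg alg k. Qed.

Let d0 k : 0 <= d k. Proof. exact: enorm_ge0. Qed.

Let Lh0 : 0 < Lh. Proof. exact: Lh_gt0 hA. Qed.

Lemma g_iterate_gt0 k : 0 < g (x k).
Proof.
have [gx _] := iterates_feasible alg k.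
by rewrite lt_neqAle eq_sym gx (g_nonneg hA).
Qed.

Let gx0 := g_iterate_gt0.

Lemma h_differentiable z : differentiable (h : 'rV[R]_n -> R^o) z.
Proof. by have [] := h_C1 hA (I : setT z). Qed.

Lemma g_differentiable z : g z != 0 -> differentiable (g : 'rV[R]_n -> R^o) z.
Proof. by move=> gz; have [] := g_C1 gz. Qed.

Lemma y_gradient k : y k = gradient g (x k).
Proof.
apply: subgradient_eq_gradient (y_subgradient alg k).
by apply: g_differentiable; rewrite gt_eqF.
Qed.

Lemma g_convex_ineq k z : g (x k) + dot (gradient g (x k)) (z - x k) <= g z.
Proof.
have := y_subgradient alg k z; rewrite /= sube0 -EFinD lee_fin y_gradient.
exact.
Qed.

Lemma fracval_ge0 z : edom f z -> 0 <= g z -> 0 <= fracval f h g z.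
Proof.
move=> fz gz; have := numerator_nonneg hA fz.
rewrite (edom_fine fp fz) -EFinD lee_fin => N0.
by rewrite /fracval divr_ge0.
Qed.

Let c0 k : 0 <= c k.
Proof. by apply: fracval_ge0 => //; exact: ltW. Qed.

Lemma numerator_iterate k : fine (f (x k)) + h (x k) = c k * g (x k).
Proof. by rewrite /c /fracval divfK// gt_eqF. Qed.

Lemma h_descent u z :
  h z <= h u + dot (gradient h u) (z - u) + Lh / 2 * enorm (z - u) ^+ 2.
Proof.
by apply: descent_lemma; [exact: h_differentiable|exact: h_gradient_lipschitz hA].
Qed.

Lemma step_subgradient k : exists2 xi, eps_subdiff f (delta k) (x k.+1) xi &
  xi = Delta k - gradient h (x k) + c k *: gradient g (x k)
       - (x k.+1 - x k) *m H k.
Proof.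
have [xi fxi E] := inexact_step alg k; exists xi => //.
rewrite -E -/(c k) y_gradient; apply/rowP => i; rewrite !mxE; ring.
Qed.

(** Approximate descent, before division by [g]: the condition on the step is
    tested with the previous iterate. *)
Lemma quotient_descent k :
  c k.+1 * g (x k.+1) + (gamma_lo - Lh / 2) * d k ^+ 2 <=
  (c k + eps k) * g (x k.+1).
Proof.
have [xi fxi xiE] := step_subgradient k.
have := eps_subdiff_fine fp (fx k.+1) (fx k) fxi.
set u := x k.+1 - x k in xiE *; rewrite -(opprB (x k.+1)) -/u dotNr => f_le.
have h_le := h_descent (x k) (x k.+1); rewrite -/u in h_le.
have g_ge := g_convex_ineq k (x k.+1); rewrite -/u in g_ge.
have cg_ge := ler_wpM2l (c0 k) g_ge.
have H_ge := loewner_ge_dot u (H_bounds k).1.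
have err := error_criterion alg k; rewrite -/u in err.
have D_le := ler_norm (dot (Delta k) u); have D2 := sqr_ge0 (enorm (Delta k)).
have N0 := numerator_iterate k; have N1 := numerator_iterate k.+1.
have xiu : dot xi u = dot (Delta k) u - dot (gradient h (x k)) u
    + c k * dot (gradient g (x k)) u - dot (u *m H k) u.
  by rewrite xiE !dotDl !dotNl dotZl.
move: f_le h_le cg_ge H_ge err D_le D2 N0 N1 xiu; rewrite /d -/u; lra.
Qed.

Section Trajectory.
Context (E : nat -> R).
Hypotheses (E0 : forall k, 0 <= E k) (E_rec : forall k, E k - E k.+1 = eps k).
Hypothesis E_to0 : E @ \oo --> 0.

Lemma quotient_bounded k : c k <= c 0%N + E 0%N.
Proof.
suff : c k + E k <= c 0%N + E 0%N by have := E0 k; lra.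
elim: k => // k; apply: le_trans.
have := quotient_descent k; have := E_rec k => Ek.
have : 0 <= (gamma_lo - Lh / 2) * d k ^+ 2.
  by rewrite mulr_ge0 ?sqr_ge0// subr_ge0 ltW.
move=> h1 h2; have : c k.+1 * g (x k.+1) <= (c k + eps k) * g (x k.+1) by lra.
by rewrite ler_pM2r//; lra.
Qed.

Lemma iterates_bounded : exists B : R, forall k, `|x k| <= B.
Proof.
have [M [_ HM]] := objective_level_bounded hA (c 0%N + E 0%N).
exists (M + 1) => k; apply: (HM (M + 1)); first by rewrite ltrDl.
rewrite /= objective_fin ?lee_fin ?quotient_bounded//.
by rewrite gt_eqF.
Qed.

Lemma g_iterates_bounded : exists2 G : R, 0 < G & forall k, g (x k) <= G.
Proof.
have [B xB] := iterates_bounded.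
have [G G0 gG] := bounded_on_bounded B (g_continuous hA).
by exists G => // k; exact: gG.
Qed.

(** Adding the remaining errors [E] to the quotient makes it nonincreasing. *)
Lemma sufficient_decrease : exists a cs : R, let r k := c k + E k - cs in
  [/\ 0 < a, forall k, 0 <= r k, r @ \oo --> 0 &
      forall k, a * d k ^+ 2 <= r k - r k.+1].
Proof.
have [G G0 gG] := g_iterates_bounded.
have gam : 0 < gamma_lo - Lh / 2 by rewrite subr_gt0.
pose a := (gamma_lo - Lh / 2) / G; have a0 : 0 < a by rewrite divr_gt0.
have dec k : a * d k ^+ 2 <= c k + E k - (c k.+1 + E k.+1).
  have desc := quotient_descent k; have Ek := E_rec k.
  have : a * d k ^+ 2 * g (x k.+1) <= (gamma_lo - Lh / 2) * d k ^+ 2.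
    have -> : a * d k ^+ 2 * g (x k.+1) =
        (gamma_lo - Lh / 2) * d k ^+ 2 * (g (x k.+1) / G).
      by rewrite /a; field; rewrite gt_eqF.
    rewrite ler_piMr ?ler_pdivrMr ?mul1r//.
    by rewrite mulr_ge0 ?sqr_ge0// ltW.
  move=> h1; have h2 : a * d k ^+ 2 * g (x k.+1) <=
      (c k + eps k - c k.+1) * g (x k.+1) by lra.
  by move: h2; rewrite ler_pM2r//; lra.
pose Phi k := c k + E k.
have Phi_mono : nonincreasing_seq Phi.
  apply/nonincreasing_seqP => k; rewrite -subr_ge0; apply: le_trans (dec k).
  by rewrite mulr_ge0 ?sqr_ge0// ltW.
have Phi_lb : has_lbound (range Phi).
  by exists 0 => _ [k _ <-]; rewrite addr_ge0.
have Phi_cvg := nonincreasing_cvgn Phi_mono Phi_lb.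
exists a, (inf (range Phi)) => r; split=> [//|k||k].
- by rewrite subr_ge0; apply: ge_inf => //; exists k.
- rewrite -(subrr (inf (range Phi))).
  by apply: cvgB; [exact: Phi_cvg|exact: cvg_cst].
- by rewrite /r; have := dec k; lra.
Qed.

Section ClusterPoint.
Context (xb : 'rV[R]_n) (cs : R).
Let r k := c k + E k - cs.
Hypothesis r_to0 : r @ \oo --> 0.
Hypothesis clus : forall (eta : R) N, 0 < eta ->
  exists2 k, (N <= k)%N & enorm (x k - xb) <= eta.

Lemma cluster_near (P : set 'rV[R]_n) N : nbhs xb P ->
  exists2 k, (N <= k)%N & P (x k).
Proof.
move=> /nbhs_enorm[rho rho0 rhoP]; have [k Nk xk] := clus N rho0.
by exists k => //; exact: rhoP.
Qed.

(** Lower semicontinuity of [f] keeps the numerator below a multiple of [g] at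
    the cluster point; hence [g] cannot vanish there. *)
Lemma cluster_feasible : edom f xb /\ 0 < g xb.
Proof.
have [M cM] : exists M : R, forall k, c k <= M.
  by exists (c 0%N + E 0%N) => k; exact: quotient_bounded.
pose v : R := M * g xb - h xb.
have ch : h @ xb --> h xb := differentiable_continuous (h_differentiable xb).
have v_cvg : (fun z => M * g z - h z) @ xb --> v.
  have cg : g @ xb --> g xb by exact: (g_continuous hA).
  exact: (cvgB (cvgM (cvg_cst M) cg) ch).
have key (A : R) : (A%:E < f xb)%E -> A <= v.
  move=> Af; rewrite leNgt; apply/negP => vA.
  have [V nV VA] := f_closed hA Af.
  have nW : \forall z \near xb, M * g z - h z < A.
    exact: (cvgr_lt _ v_cvg _ vA).
  have [k _ [Vk Wk]] := cluster_near 0 (filterI nV nW).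
  have := VA _ Vk; rewrite (edom_fine fp (fx k)) lte_fin.
  have := numerator_iterate k; have := ler_wpM2r (ltW (gx0 k)) (cM k).
  by move: Wk => /=; lra.
have fdom : edom f xb.
  rewrite /edom /= ltNge; apply/negP => foo.
  have := key (v + 1); rewrite (lt_le_trans (ltry _) foo) => /(_ isT).
  by rewrite gerDl leNgt ltr01.
split=> //; have fE := edom_fine fp fdom.
have f_le : fine (f xb) <= v.
  rewrite leNgt; apply/negP => vf.
  have := key ((fine (f xb) + v) / 2); rewrite fE lte_fin.
  have -> : (fine (f xb) + v) / 2 < fine (f xb) by lra.
  by move=> /(_ isT); lra.
rewrite lt_neqAle (g_nonneg hA fdom) andbT eq_sym; apply/eqP => gb0.
have := numerator_pos hA gb0; rewrite fE -EFinD lte_fin.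
by move: f_le; rewrite /v gb0 mulr0; lra.
Qed.

Let fb : edom f xb. Proof. by case: cluster_feasible. Qed.
Let gb0 : 0 < g xb. Proof. by case: cluster_feasible. Qed.

Lemma fracval_continuous (eta : R) : 0 < eta ->
  \forall z \near xb, edom f z -> `|fracval f h g z - fracval f h g xb| <= eta.
Proof.
move=> eta0.
have ch : h @ xb --> h xb := differentiable_continuous (h_differentiable xb).
have cf : (fine \o f) @ within (edom f) (nbhs xb) --> fine (f xb).
  apply/cvgrPdist_le => e e0.
  have [U [L [nU L0 fL]]] := f_lip fb.
  have eL : 0 < e / L by rewrite divr_gt0.
  have nW := near_enorm xb eL.
  rewrite near_withinE; near=> z => fz.
  apply: le_trans (fL xb z _ fb _ fz) _.
  - exact: nbhs_singleton nU.
  - by near: z.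
  rewrite enorm_distC mulrC -ler_pdivlMr//; near: z.
  exact: nW.
have cw : forall phi : 'rV[R]_n -> R, {for xb, continuous phi} ->
    phi @ within (edom f) (nbhs xb) --> phi xb.
  by move=> phi cphi; apply: cvg_within_filter.
have : fracval f h g @ within (edom f) (nbhs xb) --> fracval f h g xb.
  apply: cvgM; first by apply: cvgD; [exact: cf|exact: cw].
  by apply: cvgV; [rewrite gt_eqF|apply: cw; exact: g_continuous hA xb].
move=> /cvgrPdist_le /(_ _ eta0); rewrite near_withinE.
by apply: filterS => z hz fz; rewrite distrC; exact: hz.
Unshelve. all: by end_near.
Qed.

Lemma quotient_near_limit (eta : R) : 0 < eta ->
  \forall k \near \oo, `|c k - cs| <= eta.
Proof.
move=> eta0; have c_to : (fun k => c k - cs) @ \oo --> 0.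
  have -> : (fun k => c k - cs) = (fun k => r k - E k).
    by apply/funext => k; rewrite /r; ring.
  by rewrite -(subrr 0); exact: cvgB.
have /cvgrPdist_le /(_ _ eta0) := c_to.
by apply: filterS => k; rewrite sub0r normrN.
Qed.

Lemma cluster_value : fracval f h g xb = cs.
Proof.
apply/eqP; rewrite -subr_eq0 -normr_le0; apply/ler_addgt0Pr => eta eta0.
have eta2 : 0 < eta / 2 by rewrite divr_gt0.
have [N _ HN] := quotient_near_limit eta2.
have [k Nk hk] := cluster_near N (fracval_continuous eta2).
have := HN k Nk; have := hk (fx k); rewrite -/(c k) add0r distrC.
by have := ler_distD (c k) (fracval f h g xb) cs; lra.
Qed.

Lemma subgradient_rearrange (D h0 h1 g0 g1 v : 'rV[R]_n) (p q : R) :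
  D - h0 + p *: g0 - v + h1 - q *: g1 =
  D + (h1 - h0) + p *: (g0 - g1) + (p - q) *: g1 - v.
Proof. by apply/rowP => i; rewrite !mxE; ring. Qed.

(** Near the cluster point a vanishing [delta k] yields a subgradient of the
    quotient whose size is controlled by the step and the error. *)
Lemma small_subgradient : exists rho C : R, [/\ 0 < rho, 0 < C &
  forall k, delta k = 0 -> enorm (x k - xb) <= rho ->
    enorm (x k.+1 - xb) <= rho ->
    exists2 w, frechet_subdiff (objective f h g) (x k.+1) w &
      enorm w <= C * (d k + Num.sqrt (eps k))].
Proof.
have [G G0 gG] := g_iterates_bounded.
have [Of [Lf [nOf Lf0 fL]]] := f_lip fb.
have gb : Omega g xb by rewrite /Omega /= gt_eqF.
have [Og [Lg [nOg Lg0 gL]]] := g_lip gb.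
have gb2 : 0 < g xb / 2 by rewrite divr_gt0.
have near_g : \forall z \near xb, g xb / 2 <= g z.
  have cg : g @ xb --> g xb by exact: (g_continuous hA).
  have /cvgrPdist_le /(_ _ gb2) := cg.
  by apply: filterS => z hz; have := ler_norm (g xb - g z); lra.
have [rho0 rho00 Hrho] := nbhs_enorm (filterI nOf (filterI nOg near_g)).
pose rho := Num.min rho0 1.
have rho_gt0 : 0 < rho by rewrite lt_min rho00 ltr01.
have rho_le1 : rho <= 1 by rewrite ge_min lexx orbT.
have rho_le : rho <= rho0 by rewrite ge_min lexx.
have ball z : enorm (z - xb) <= rho -> [/\ Of z, Og z & g xb / 2 <= g z].
  by move=> hz; have [? [? ?]] := Hrho z (le_trans hz rho_le).
have xb0 : enorm (xb - xb) <= rho by rewrite subrr enorm0 ltW.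
pose M : R := c 0%N + E 0%N; have M0 : 0 <= M by rewrite addr_ge0.
pose Gg := enorm (gradient g xb) + Lg.
pose Hh := enorm (gradient h xb) + Lh.
have Gg0 : 0 <= Gg by rewrite addr_ge0 ?enorm_ge0// ltW.
have Hh0 : 0 <= Hh by rewrite addr_ge0 ?enorm_ge0// ltW.
have grad_g k : enorm (x k - xb) <= rho -> enorm (gradient g (x k)) <= Gg.
  move=> hk; have [_ Ogk _] := ball _ hk; have [_ Ogb _] := ball _ xb0.
  have Omk : Omega g (x k) by rewrite /Omega /= gt_eqF.
  have h1 := enorm_triangle (gradient g (x k) - gradient g xb) (gradient g xb).
  rewrite subrK in h1; apply: le_trans h1 _; rewrite addrC lerD2l.
  apply: le_trans (gL _ _ Ogk Omk Ogb gb) _.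
  by rewrite ler_piMr ?(ltW Lg0)// (le_trans hk).
have grad_h k : enorm (x k - xb) <= rho -> enorm (gradient h (x k)) <= Hh.
  move=> hk.
  have h1 := enorm_triangle (gradient h (x k) - gradient h xb) (gradient h xb).
  rewrite subrK in h1; apply: le_trans h1 _; rewrite addrC lerD2l.
  apply: le_trans (h_gradient_lipschitz hA _ _) _.
  by rewrite ler_piMr ?(ltW Lh0)// (le_trans hk).
pose Lc := (Lf + Hh + Lh + M * Gg) / (g xb / 2).
have Lc0 : 0 <= Lc.
  rewrite divr_ge0 ?(ltW gb2)//; have := mulr_ge0 M0 Gg0.
  by move: Lf0 Lh0; lra.
pose C := (Num.sqrt G + Lh + M * Lg + Lc * Gg + gamma_hi) / (g xb / 2).
have sG0 : 0 < Num.sqrt G by rewrite sqrtr_gt0.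
have inner0 : 0 <= Lh + M * Lg + Lc * Gg + gamma_hi.
  have := mulr_ge0 M0 (ltW Lg0); have := mulr_ge0 Lc0 Gg0.
  by move: Lh0 gamma_hi_gt0; lra.
exists rho, C; split=> // [|k dk0 xk xk1].
  by rewrite divr_gt0//; lra.
have [Ofk Ogk gk2] := ball _ xk; have [Ofk1 Ogk1 gk12] := ball _ xk1.
have dk := d0 k; set u := x k.+1 - x k.
have du : enorm u = d k by [].
have d_le2 : d k <= 2.
  have := enorm_dist_triangle (x k.+1) xb (x k).
  by rewrite [enorm (xb - _)]enorm_distC /d; lra.
have d2_le : Lh / 2 * d k ^+ 2 <= Lh * d k.
  have := ler_wpM2r dk d_le2; rewrite -expr2 => h1.
  by have := ler_wpM2l (ltW Lh0) h1; lra.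
have ck_le : c k <= M := quotient_bounded k.
have Nu : x k - x k.+1 = - u by rewrite opprB.
have f_diff : `|fine (f (x k.+1)) - fine (f (x k))| <= Lf * d k by apply: fL.
have h_diff : `|h (x k.+1) - h (x k)| <= (Hh + Lh) * d k.
  have h1 := h_descent (x k) (x k.+1); have h2 := h_descent (x k.+1) (x k).
  rewrite -/u du in h1; rewrite Nu enormN dotNr du in h2.
  have h3 := le_trans (dot_le_enorm (gradient h (x k)) u)
    (ler_wpM2r (enorm_ge0 u) (grad_h _ xk)).
  have h4 := le_trans (dot_le_enorm (gradient h (x k.+1)) u)
    (ler_wpM2r (enorm_ge0 u) (grad_h _ xk1)).
  rewrite !ler_norml du in h3 h4 *; move: h3 h4 => /andP[_ h3] /andP[h4 _].
  clear gk2 gk12 ck_le d_le2 dk M0 Gg0 Hh0 Lc0 inner0 sG0 gb2.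
  by apply/andP; split; lra.
(* Each end point of the step carries a subgradient of [g]. *)
have g_diff : `|g (x k.+1) - g (x k)| <= Gg * d k.
  have h1 := g_convex_ineq k (x k.+1); have h2 := g_convex_ineq k.+1 (x k).
  rewrite -/u in h1; rewrite Nu dotNr in h2.
  have h3 := le_trans (dot_le_enorm (gradient g (x k)) u)
    (ler_wpM2r (enorm_ge0 u) (grad_g _ xk)).
  have h4 := le_trans (dot_le_enorm (gradient g (x k.+1)) u)
    (ler_wpM2r (enorm_ge0 u) (grad_g _ xk1)).
  rewrite !ler_norml du in h3 h4 *; move: h3 h4 => /andP[h3 _] /andP[_ h4].
  clear h_diff f_diff d2_le gk2 gk12 ck_le d_le2 dk M0 Gg0 Hh0 Lc0 inner0 sG0 gb2.
  by apply/andP; split; lra.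
have c_diff : `|c k - c k.+1| <= Lc * d k.
  rewrite distrC /Lc mulrAC ler_pdivlMr//.
  apply: (@le_trans _ _ (`|c k.+1 - c k| * g (x k.+1))).
    by rewrite ler_wpM2l.
  rewrite -(ger0_norm (ltW (gx0 k.+1))) -normrM.
  have -> : (c k.+1 - c k) * g (x k.+1) =
      fine (f (x k.+1)) - fine (f (x k)) + (h (x k.+1) - h (x k))
      - c k * (g (x k.+1) - g (x k)).
    have := numerator_iterate k; have := numerator_iterate k.+1 => N1 N0.
    by rewrite mulrBl -N1 [_ * (_ - _)]mulrBr -N0; ring.
  apply: le_trans (ler_normB _ _) _.
  apply: le_trans (lerD (ler_normD _ _) (lexx _)) _.
  rewrite normrM (ger0_norm (c0 k)).
  have : c k * `|g (x k.+1) - g (x k)| <= M * (Gg * d k) by rewrite ler_pM.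
  by move: f_diff h_diff; lra.
have [xi fxi xiE] := step_subgradient k; rewrite dk0 in fxi.
exists ((g (x k.+1))^-1 *: (xi + gradient h (x k.+1)
    - c k.+1 *: gradient g (x k.+1))).
  have dg := g_differentiable (lt0r_neq0 (gx0 k.+1)).
  exact: (frechet_objective fp (fx _) (gx0 _) (c0 _) (h_differentiable _) dg fxi).
rewrite xiE subgradient_rearrange.
(* The error criterion bounds the square of [Delta k]. *)
have Delta_le : enorm (Delta k) <= Num.sqrt G * Num.sqrt (eps k).
  rewrite -sqrtrM ?(ltW G0)// -(ger0_norm (enorm_ge0 (Delta k))) -sqrtr_sqr.
  rewrite ler_sqrt ?mulr_ge0 ?(ltW G0)//.
  have := error_criterion alg k; rewrite dk0 addr0 => err.
  have := normr_ge0 (dot (Delta k) (x k.+1 - x k)).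
  have : eps k * g (x k.+1) <= eps k * G by rewrite ler_wpM2l.
  by rewrite [G * _]mulrC; move: err; lra.
have gh_le : enorm (gradient h (x k.+1) - gradient h (x k)) <= Lh * d k.
  exact: h_gradient_lipschitz hA _ _.
have gg_le : enorm (c k *: (gradient g (x k) - gradient g (x k.+1)))
    <= M * Lg * d k.
  rewrite enormZ (ger0_norm (c0 k)) -mulrA ler_pM ?enorm_ge0//.
  rewrite enorm_distC; apply: gL => //; rewrite /Omega /= gt_eqF//.
have cg_le : enorm ((c k - c k.+1) *: gradient g (x k.+1)) <= Lc * Gg * d k.
  rewrite enormZ mulrAC; apply: ler_pM; rewrite ?enorm_ge0//.
  exact: grad_g.
have H_psd : possemidef (H k).
  have [sH pH] := H_posdef alg k; split=> // v.
  by have [->|v0] := eqVneq v 0; [rewrite dot0r|exact/ltW/pH].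
have uH_le : enorm (u *m H k) <= gamma_hi * d k.
  by apply: enorm_mulmx_le => //; [exact: ltW|exact: (H_bounds k).2].
set A1 := Delta k; set A2 := gradient h _ - _; set A3 := c k *: _.
set A4 := (c k - c k.+1) *: _; set A5 := u *m _.
have total : enorm (A1 + A2 + A3 + A4 - A5) <=
    (Num.sqrt G + Lh + M * Lg + Lc * Gg + gamma_hi) * (d k + Num.sqrt (eps k)).
  apply: le_trans (enormB_triangle _ _) _.
  apply: le_trans (lerD (enorm_triangle _ _) (lexx _)) _.
  apply: le_trans (lerD (lerD (enorm_triangle _ _) (lexx _)) (lexx _)) _.
  apply: le_trans
    (lerD (lerD (lerD (enorm_triangle _ _) (lexx _)) (lexx _)) (lexx _)) _.
  apply: le_trans
    (lerD (lerD (lerD (lerD Delta_le gh_le) gg_le) cg_le) uH_le) _.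
  rewrite -subr_ge0; set sum := (X in 0 <= X).
  have -> : sum = Num.sqrt G * d k +
      (Lh + M * Lg + Lc * Gg + gamma_hi) * Num.sqrt (eps k).
    by rewrite /sum; ring.
  by rewrite addr_ge0 ?mulr_ge0 ?sqrtr_ge0// ltW.
rewrite enormZ ger0_norm ?invr_ge0 ?(ltW (gx0 _))//.
rewrite mulrC ler_pdivrMr//; apply: le_trans total _.
set D := d k + _; have D0 : 0 <= D by rewrite addr_ge0 ?sqrtr_ge0.
pose S := Num.sqrt G + Lh + M * Lg + Lc * Gg + gamma_hi; rewrite -/S.
have S0 : 0 <= S by rewrite /S; lra.
have -> : C * D * g (x k.+1) = S * D * (g (x k.+1) / (g xb / 2)).
  by rewrite /C -/S; ring.
by rewrite ler_peMr ?mulr_ge0// ler_pdivlMr ?mul1r.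
Qed.

End ClusterPoint.
End Trajectory.
End Iterates.

(** * The Kurdyka-Lojasiewicz inequality along the iterates *)

Section KLAlongSequence.
Context {R : realType} {n : nat}.
Context (psi : 'rV[R]_n -> \bar R) (x : nat -> 'rV[R]_n) (xb : 'rV[R]_n).
Context (c eps E : nat -> R) (cs theta : R) (rho0 C0 : R) (K0 : nat).
Let d k := enorm (x k.+1 - x k).
Let r k := c k + E k - cs.
Hypothesis psi_x : forall k, psi (x k) = (c k)%:E.
Hypothesis psi_xb : psi xb = cs%:E.
Hypothesis c_to : forall eta : R, 0 < eta ->
  \forall k \near \oo, `|c k - cs| <= eta.
Hypothesis d_to : forall eta : R, 0 < eta -> \forall k \near \oo, d k <= eta.
Hypothesis eps_to : forall eta : R, 0 < eta ->
  \forall k \near \oo, Num.sqrt (eps k) <= eta.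
Hypothesis clus : forall (eta : R) N, 0 < eta ->
  exists2 k, (N <= k)%N & enorm (x k - xb) <= eta.
Hypotheses (rho00 : 0 < rho0) (C00 : 0 < C0).
Hypothesis subgradients : forall k, (K0 <= k)%N -> enorm (x k - xb) <= rho0 ->
  enorm (x k.+1 - xb) <= rho0 ->
  exists2 w, frechet_subdiff psi (x k.+1) w &
    enorm w <= C0 * (d k + Num.sqrt (eps k)).

Lemma frechet_limiting z w : frechet_subdiff psi z w -> limiting_subdiff psi z w.
Proof.
move=> fw; split; first by case: fw.
by exists (fun=> z), (fun=> w); split=> //; exact: cvg_cst.
Qed.

(** The cluster point is critical, so the inequality is available there. *)
Lemma zero_limiting_subdiff : limiting_subdiff psi xb 0.
Proof.
have pick (j : nat) : exists kw : nat * 'rV[R]_n,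
    [/\ frechet_subdiff psi (x kw.1) kw.2, enorm (x kw.1 - xb) <= j.+1%:R^-1,
        `|c kw.1 - cs| <= j.+1%:R^-1 & enorm kw.2 <= j.+1%:R^-1].
  set eta : R := j.+1%:R^-1; have eta0 : 0 < eta by rewrite invr_gt0 ltr0n.
  pose s := Num.min (Num.min (eta / 2) (rho0 / 2)) (eta / (2 * C0)).
  have s0 : 0 < s by rewrite !lt_min !divr_gt0// mulr_gt0.
  have s1 : s <= eta / 2 by rewrite !ge_min lexx.
  have s2 : s <= rho0 / 2 by rewrite !ge_min lexx orbT.
  have s3 : C0 * s <= eta / 2.
    rewrite mulrC -ler_pdivlMr// -mulrA -invfM.
    by rewrite !ge_min lexx orbT.
  have [N _ HN] : \forall k \near \oo,
      [/\ (K0 <= k)%N, d k <= s, Num.sqrt (eps k) <= s & `|c k - cs| <= eta].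
    near=> k; split; near: k.
    - by exists K0.
    - exact: d_to.
    - exact: eps_to.
    - exact: c_to.
  have [k Nk xk] := clus N s0; have [Kk dk ek _] := HN k Nk.
  have [_ _ _ ck1] := HN k.+1 (leqW Nk).
  have xk1 := enorm_dist_triangle (x k.+1) (x k) xb; rewrite -/(d k) in xk1.
  have [||w fw w_le] := subgradients Kk; [lra|lra|].
  exists (k.+1, w); split=> //=; first by lra.
  apply: le_trans w_le _.
  have := ler_wpM2l (ltW C00) dk; have := ler_wpM2l (ltW C00) ek.
  by rewrite mulrDr; lra.
have [kw Hkw] := choice pick.
have inv_to (eta : R) : 0 < eta -> \forall j \near \oo, (j.+1%:R : R)^-1 <= eta.
  move=> eta0; have [N _ HN] := near_infty_natSinv_lt (PosNum eta0).
  by exists N => // j Nj; apply/ltW/HN.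
split; first by rewrite /edom /= psi_xb ltry.
exists (fun j => x (kw j).1), (fun j => (kw j).2); split.
- by move=> j; have [] := Hkw j.
- apply: cvg_enorm => eta eta0; apply: filterS (inv_to _ eta0) => j.
  by apply: le_trans; have [] := Hkw j.
- rewrite psi_xb; have -> : (fun j => psi (x (kw j).1)) =
      (fun j => (c (kw j).1)%:E) by apply/funext => j; exact: psi_x.
  apply: cvg_EFin; first by near=> j.
  apply/cvgrPdist_le => eta eta0; apply: filterS (inv_to _ eta0) => j.
  by apply: le_trans; have [_ _ + _] := Hkw j; rewrite distrC.
- apply: cvg_enorm => eta eta0; apply: filterS (inv_to _ eta0) => j.
  by apply: le_trans; rewrite subr0; have [] := Hkw j.
Unshelve. all: by end_near.
Qed.

Hypotheses (E0 : forall k, 0 <= E k) (r0 : forall k, 0 <= r k).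

(** The exponent may be increased, because close to the limit the differences of
    values are at most [1]. *)
Lemma KL_along_sequence (t : R) : KL_function psi theta -> theta <= t ->
  0 < t < 1 ->
  exists rho C (K : nat), [/\ 0 < rho, 0 < C & forall k, (K <= k)%N ->
    enorm (x k - xb) <= rho -> enorm (x k.+1 - xb) <= rho ->
    r k.+1 `^ t <= C * (d k + (Num.sqrt (eps k) + E k.+1 `^ t))].
Proof.
move=> [_ KLp] theta_t /andP[t0 t1].
have [|a [mu [nu [a0 mu0 nu0 kl]]]] := KLp xb.
  by exists 0; exact: zero_limiting_subdiff.
pose m := Num.min (nu / 2) 1.
have m0 : 0 < m by rewrite lt_min divr_gt0//= ltr01.
have [N _ HN] := c_to m0.
pose C := 3 * (C0 / a + 1).
have Ca : 0 < C0 / a by rewrite divr_gt0.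
exists (Num.min rho0 mu), C, (maxn K0 N); split.
- by rewrite lt_min rho00.
- by rewrite mulr_gt0//; lra.
move=> k; rewrite geq_max => /andP[Kk Nk]; rewrite !le_min.
move=> /andP[xk _] /andP[xk1 xk1mu].
have [w fw w_le] := subgradients Kk xk xk1.
set S := d k + Num.sqrt (eps k) in w_le *.
have S0 : 0 <= S by rewrite addr_ge0 ?enorm_ge0 ?sqrtr_ge0.
set Et := E k.+1 `^ t; have Et0 : 0 <= Et := powR_ge0 _ _.
have := HN k.+1 (leqW Nk); rewrite /= le_min => /andP[cnu c1].
have C_ge : S + Et <= C * (S + Et).
  by rewrite ler_peMl ?(addr_ge0 S0 Et0)// /C; lra.
rewrite addrA -/S -/Et.
(* Below the limit the inequality says nothing, but there [r] is at most [E]. *)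
have [c_le|c_gt] := leP (c k.+1) cs.
  have rE : r k.+1 `^ t <= Et.
    by rewrite ge0_ler_powR ?nnegrE ?r0 ?E0 ?(ltW t0)// /r; lra.
  by apply: le_trans C_ge; lra.
have v0 : 0 < c k.+1 - cs by rewrite subr_gt0.
rewrite ger0_norm ?(ltW v0)// in cnu c1.
have kl1 : a * (c k.+1 - cs) `^ theta <= C0 * S.
  apply: le_trans w_le; rewrite -lee_fin.
  have := kl (x k.+1); rewrite psi_x psi_xb -EFinB poweR_EFin -EFinM.
  move=> h; apply: le_trans (h _ _ _ _) _ => //.
  - by exists w; exact: frechet_limiting.
  - by rewrite -EFinD lte_fin; lra.
  - by apply: ereal_inf_lbound; exists w => //; exact: frechet_limiting.
have kl2 : (c k.+1 - cs) `^ t <= C0 / a * S.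
  rewrite mulrAC ler_pdivlMr// mulrC; apply: le_trans kl1.
  by rewrite ler_pM2l//; apply: ger_powR => //; rewrite v0.
have := powR_add3_le (ltW t0) (ltW v0) (E0 k.+1) (lexx 0).
rewrite addr0 (_ : c k.+1 - cs + E k.+1 = r k.+1); last by rewrite /r; ring.
rewrite powR0 ?gt_eqF// addr0 -/Et => h; apply: le_trans h _.
have t3 : 3 `^ t <= 3 :> R by apply: ler1_powR; lra.
apply: (@le_trans _ _ (3 * (C0 / a * S + Et))).
  apply: ler_pM => //.
  - by rewrite addr_ge0 ?powR_ge0.
  - by rewrite lerD2r.
have := mulr_ge0 (ltW Ca) Et0; rewrite /C; lra.
Qed.

End KLAlongSequence.

(** * Convergence and rates of the algorithm *)

Lemma bounded_sums_error (R : realType) (eps E : nat -> R) (s t : R) :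
  (forall k, 0 <= E k) -> (forall k, 0 <= eps k) ->
  (forall k, E k - E k.+1 = eps k) -> E @ \oo --> 0 -> 0 < s -> s <= t ->
  bounded_sums (fun k => Num.sqrt (eps k)) -> bounded_sums (fun k => E k `^ s) ->
  bounded_sums (fun k => Num.sqrt (eps k) + E k.+1 `^ t).
Proof.
move=> E0 eps0 E_rec E_to0 s0 st sqrtS ES; apply: bounded_sumsD => //.
have [N _ HN] := cvgr_le _ E_to0 _ ltr01.
apply: (@bounded_sums_le _ _ _ N _ _ _ ES) => k; try exact: powR_ge0.
move=> Nk; have Ek1 : E k.+1 <= 1 by apply: HN; exact: leqW.
have [->|Ek] := eqVneq (E k.+1) 0.
  by rewrite powR0 ?powR_ge0// gt_eqF// (lt_le_trans s0).
have Ek0 : 0 < E k.+1 by rewrite lt_neqAle eq_sym Ek E0.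
apply: (@le_trans _ _ (E k.+1 `^ s)); first by apply: ger_powR; rewrite ?Ek0.
rewrite ge0_ler_powR ?nnegrE ?E0 ?(ltW s0)//.
by have := eps0 k; rewrite -E_rec subr_ge0.
Qed.

Lemma half_le_exponent (R : realType) (al : R) : 0 < al ->
  1 / 2 <= (1 + al) / (1 + 2 * al).
Proof. by move=> al0; rewrite ler_pdivlMr; lra. Qed.

Unset Implicit Arguments.

Theorem theorem4p3 (R : realType) (n : nat)
  (f : 'rV[R]_n -> \bar R) (h g : 'rV[R]_n -> R) (Lh : R)
  (eps : nat -> R) (H : nat -> 'M[R]_n)
  (x y Delta : nat -> 'rV[R]_n) (delta : nat -> R)
  (gamma_lo gamma_hi tau theta eps0 : R)
  (hA : standing_assumptions f h g Lh)
  (h1 : f_locally_lipschitz f)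
  (h2 : continuously_differentiable_on (Omega g) g)
  (h2' : g_gradient_locally_lipschitz g)
  (h3 : iVPGSA f h g eps H x y Delta delta)
  (h3' : exists2 K0 : nat, (0 < K0)%N &
     forall k : nat, (K0 <= k)%N -> delta k = 0)
  (h4_lo_pos : 0 < gamma_lo) (h4_hi_pos : 0 < gamma_hi)
  (h4_lo : Lh / 2 < gamma_lo) (h4_lo_hi : gamma_lo <= gamma_hi)
  (h4 : forall k : nat, loewner_le gamma_lo%:M (H k) /\
                        loewner_le (H k) gamma_hi%:M)
  (h5_tau : 1 < tau)
  (h5_eps : (\sum_(0 <= k <oo) (eps k)%:E < +oo)%E)
  (h5_sqrt : (\sum_(0 <= k <oo) (Num.sqrt (eps k))%:E < +oo)%E)
  (h5_tail : (\sum_(0 <= k <oo)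
                (\sum_(k <= i <oo) (eps i)%:E) `^ (1 - 1 / tau) < +oo)%E)
  (h6 : KL_function (objective f h g) theta)
  (heps0 : 0 < eps0) :
  exists2 xs : 'rV[R]_n, x @ \oo --> xs &
  let err := fun k : nat => enorm (x k - xs) in
  let geometric := fun zeta : R => forall k : nat, eps k = eps0 * zeta ^+ k in
  let polynomial := fun q : R =>
    forall k : nat, eps k = eps0 / (k.+1%:R `^ q) in
  [/\ theta = 0 ->
        (forall zeta : R, 0 < zeta < 1 -> geometric zeta ->
           exists2 rho : R, 0 < rho < 1 &
             eventually_bigO err (fun k => rho ^+ k)) /\
        (forall q : R, 2 < q -> polynomial q ->
           eventually_bigO err (fun k => k%:R `^ (- (q / 2 - 1)))),
      0 < theta <= 1 / 2 ->
        (forall zeta : R, 0 < zeta < 1 -> geometric zeta ->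
           exists2 rho : R, 0 < rho < 1 &
             eventually_bigO err (fun k => rho ^+ k)) /\
        (forall q : R, 2 < q -> polynomial q ->
           eventually_bigO err (fun k => k%:R `^ (- (q / 2 - 1))))
    & 1 / 2 < theta < 1 ->
        (forall zeta : R, 0 < zeta < 1 -> geometric zeta ->
           eventually_bigO err
             (fun k => k%:R `^ (- ((1 - theta) / (2 * theta - 1))))) /\
        (forall q : R, 2 < q -> polynomial q ->
           (q < 2 * theta / (2 * theta - 1) ->
              eventually_bigO err (fun k => k%:R `^ (- (q / 2 - 1)))) /\
           (2 * theta / (2 * theta - 1) <= q ->
              eventually_bigO err
                (fun k => k%:R `^ (- ((1 - theta) / (2 * theta - 1))))))].
Proof.
have eps_nn := eps_nonneg h3.
have [E [E0 E_rec E_to0 E_tail]] := real_tails eps_nn h5_eps.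
have [a [cs [a0 r0 r_to0 desc]]] :=
  sufficient_decrease hA h2 h3 h4_lo h4 E0 E_rec.
have [B xB] := iterates_bounded hA h2 h3 h4_lo h4 E0 E_rec.
have [xb clus] := bounded_seq_cluster xB.
have [fb gb] := cluster_feasible hA h2 h3 h4_lo h4 E0 E_rec clus.
have [rho0 [C0 [rho00 C00 subg]]] :=
  small_subgradient hA h1 h2 h2' h3 h4_lo h4_hi_pos h4 E0 E_rec clus.
have [K0 _ delta0] := h3'.
have {}subg k (Kk : (K0 <= k)%N) := subg k (delta0 k Kk).
have Fx k : objective f h g (x k) = (fracval f h g (x k))%:E.
  have [_ fx] := iterates_feasible h3 k.
  by rewrite objective_fin// gt_eqF// (g_iterate_gt0 hA h3).
have Fxb : objective f h g xb = cs%:E.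
  rewrite objective_fin ?gt_eqF//; congr (_%:E).
  exact: (cluster_value hA h1 h2 h3 h4_lo h4 E0 E_rec E_to0 r_to0 clus).
have c_to (eta : R) := @quotient_near_limit _ _ f h g x E E_to0 cs r_to0 eta.
have d_to (eta : R) := @step_vanishes _ _ a x _ a0 r0 desc eta r_to0.
have eps_to (eta : R) : 0 < eta -> \forall k \near \oo, Num.sqrt (eps k) <= eta.
  move=> eta0; have eta2 : 0 < eta ^+ 2 by rewrite exprn_gt0.
  apply: filterS (cvgr_le _ E_to0 _ eta2) => k Ek.
  rewrite -(@ler_pXn2r _ 2)// ?nnegrE ?sqrtr_ge0 ?(ltW eta0)//.
  rewrite sqr_sqrtr//; have := E_rec k; have := E0 k.+1; lra.
have KL t := @KL_along_sequence _ _ _ _ _ _ _ _ _ _ _ _ _ Fx Fxb c_to d_to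
  eps_to clus rho00 C00 subg E0 r0 t h6.
have [/andP[theta0 theta1] _] := h6.
pose s : R := 1 - 1 / tau.
(* Convergence uses the exponent [t], for which the errors are summable. *)
have s01 : 0 < s < 1.
  have tau0 : 0 < tau by lra.
  have i0 : 0 < 1 / tau by rewrite divr_gt0.
  have i1 : 1 / tau < 1 by rewrite ltr_pdivrMr ?mul1r.
  by rewrite /s; lra.
have /andP[s0 s1] := s01.
pose t := Num.max theta s.
have t01 : 0 < t < 1 by rewrite lt_max s0 orbT gt_max theta1 s1.
have sqrtS : bounded_sums (fun k => Num.sqrt (eps k)).
  by apply: bounded_sums_ereal => // k; exact: sqrtr_ge0.
have ES : bounded_sums (fun k => E k `^ s).
  apply: bounded_sums_ereal => [k|]; first exact: powR_ge0.
  rewrite (eq_eseriesr (g := fun k =>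
    (\sum_(k <= i <oo) (eps i)%:E) `^ (1 - 1 / tau))%E) => [|k _].
    exact: h5_tail.
  by rewrite E_tail poweR_EFin.
have x_to (eta : R) : 0 < eta -> \forall k \near \oo, enorm (x k - xb) <= eta.
  have theta_t : theta <= t by rewrite le_max lexx.
  have s_t : s <= t by rewrite le_max lexx orbT.
  have [rho [C [K [rho_gt0 C_gt0 kl]]]] := KL t theta_t t01.
  have eS := bounded_sums_error E0 eps_nn E_rec E_to0 s0 s_t sqrtS ES.
  have e_ge0 k : 0 <= Num.sqrt (eps k) + E k.+1 `^ t.
    by rewrite addr_ge0 ?sqrtr_ge0 ?powR_ge0.
  move=> eta0.
  exact: (trapping t01 a0 C_gt0 e_ge0 r0 desc rho_gt0 kl r_to0 eS clus eta0).
have {}KL t' : theta <= t' -> 0 < t' < 1 -> exists2 C : R, 0 < C &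
    \forall k \near \oo, (fracval f h g (x k.+1) + E k.+1 - cs) `^ t' <=
      C * (enorm (x k.+1 - x k) + (Num.sqrt (eps k) + E k.+1 `^ t')).
  move=> theta_t' t'01.
  have [rho [C [K [rho_gt0 C_gt0 kl]]]] := KL t' theta_t' t'01.
  exists C => //; have [N _ HN] := x_to _ rho_gt0.
  exists (maxn K N) => // k /=; rewrite geq_max => /andP[Kk Nk].
  by apply: kl => //; apply: HN; [exact: Nk|exact: leqW].
exists xb; first exact: cvg_enorm.
have poly_rate := polynomial_rate a0 r0 r_to0 desc x_to E0 E_rec E_to0 KL.
have lin_rate := geometric_linear_rate a0 r0 desc x_to E0 E_rec E_to0 KL heps0.
have sub_rate := geometric_sublinear_rate a0 r0 r_to0 desc x_to E0 E_rec E_to0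
  KL heps0.
have small_theta : theta <= 1 / 2 ->
  (forall zeta : R, 0 < zeta < 1 -> (forall k, eps k = eps0 * zeta ^+ k) ->
     exists2 rho : R, 0 < rho < 1 &
       eventually_bigO (fun k => enorm (x k - xb)) (fun k => rho ^+ k)) /\
  (forall q : R, 2 < q -> (forall k, eps k = eps0 / (k.+1%:R `^ q)) ->
     eventually_bigO (fun k => enorm (x k - xb))
       (fun k => k%:R `^ (- (q / 2 - 1)))).
  move=> theta_half; split=> [zeta zeta01 geo|q q2 pol].
    exact: (lin_rate zeta zeta01 geo theta_half).
  have al0 : 0 < q / 2 - 1 by lra.
  apply: (poly_rate eps0 q heps0 q2 pol _ al0 (lexx _)).
  exact: le_trans theta_half (half_le_exponent al0).
split=> [theta_0|/andP[_ theta_half]|/andP[theta_half _]].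
- by apply: small_theta; rewrite theta_0; lra.
- exact: small_theta.
have th2 : 0 < 2 * theta - 1 by lra.
set al := (1 - theta) / (2 * theta - 1).
have al0 : 0 < al by rewrite divr_gt0// subr_gt0.
(* This choice of [al] is the one whose exponent is [theta]. *)
have al_theta : (1 + al) / (1 + 2 * al) = theta.
  by rewrite /al; field; rewrite !gt_eqF//; lra.
split=> [zeta zeta01 geo|q q2 pol].
  by apply: (sub_rate zeta zeta01 geo al al0); rewrite al_theta.
split=> q_cmp.
- have al0' : 0 < q / 2 - 1 by lra.
  apply: (poly_rate eps0 q heps0 q2 pol _ al0' (lexx _)).
  move: q_cmp; rewrite ltr_pdivlMr// ler_pdivlMr; lra.
- apply: (poly_rate eps0 q heps0 q2 pol al al0); last by rewrite al_theta.
  by move: q_cmp; rewrite /al !ler_pdivrMr//; lra.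
Qed.
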